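(* Let $X$ be a complete $\mathrm{CAT}(-1)$-space, let $(R_k)_{k\in\mathbf N}$ be a sequence of representations $\mathbf F_r\to\mathrm{Isom}\,X$ and let $R_\infty:\mathbf F_r\to\mathrm{Isom}\,X$ be a Schottky representation. Assume that $\lim_kR_k(g)=R_\infty(g)$ in $\mathrm{Isom}\,X$ for every $g\in\mathbf F_r$. Then $$\lim_k\mathrm{Hdim}(\Lambda_{R_k})=\mathrm{Hdim}(\Lambda_{R_\infty}).$$
   Context: $\mathbf F_r$ ($r\ge2$) is the free group on $r$ generators, with word length $|\cdot|$. A $\mathrm{CAT}(-1)$-space is a geodesic metric space whose geodesic triangles are at least as thin as their comparison triangles in the hyperbolic plane; local compactness is not assumed. $\mathrm{Isom}\,X$ carries the compact-open topology, equivalently pointwise convergence: $g_n\to g$ iff $g_n(x)\to g(x)$ for all $x\in X$. Fix a base point $o\in X$. The Gromov product is $\langle x,y\rangle_z=\frac12(d(x,z)+d(y,z)-d(x,y))$. The boundary $\partial X$ is the set of classes of sequences $(x_n)$ with $\langle x_n,x_m\rangle_o\to\infty$, two sequences being equivalent if $\langle x_n,y_n\rangle_o\to\infty$; the Gromov product extends continuously to $\partial X$, which carries the visual metric $d_o(\xi,\zeta)=e^{-\langle\xi,\zeta\rangle_o}$. $\mathrm{Hdim}$ is the Hausdorff dimension with respect to $d_o$. A representation $\rho:\mathbf F_r\to\mathrm{Isom}\,X$ is Schottky if, for some $K\ge1$, its orbit map $\tau_\rho(g)=\rho(g)\cdot o$ satisfies $\frac1K|g^{-1}h|-K\le d(\tau_\rho(g),\tau_\rho(h))\le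 K|g^{-1}h|+K$ for all $g,h$. The limit set $\Lambda_\rho$ is the set of accumulation points in $\partial X$ of the orbit of $o$; for Schottky $\rho$ it is the image of $\partial\mathbf F_r$ under the continuous extension of $\tau_\rho$. *)

(* Defs.v *)
From HB Require Import structures.
From mathcomp Require Import all_boot all_order all_algebra.
From mathcomp Require Import all_classical all_reals all_analysis.
Import numFieldNormedType.Exports.

Set Implicit Arguments.
Unset Strict Implicit.
Unset Printing Implicit Defensive.

Import Order.TTheory GRing.Theory Num.Theory.

Local Open Scope classical_set_scope.
Local Open Scope ring_scope.

(* A letter is a generator ((i, false)) or its inverse ((i, true)); the free
   group is the set of reduced words, with product the reduced form of the
   concatenation. *)
Notation letter r := ('I_r * bool)%type.

Section ReducedWords.
Variable r : nat.
Implicit Types (a b : letter r) (w : seq (letter r)).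

Definition linv a : letter r := (a.1, ~~ a.2).

Definition reduced w : bool := sorted (fun a b => b != linv a) w.

Definition wcons a w : seq (letter r) :=
  if w is b :: w' then if b == linv a then w' else a :: w else [:: a].

Definition wmul w1 w2 : seq (letter r) := foldr wcons w2 w1.

Definition winv w : seq (letter r) := rev (map linv w).

Lemma linvK : involutive linv.
Proof. by case=> i b; rewrite /linv /= negbK. Qed.

Lemma reduced_behead a w : reduced (a :: w) -> reduced w.
Proof. exact: path_sorted. Qed.

Lemma wcons_reduced a w : reduced w -> reduced (wcons a w).
Proof.
case: w => [//|b w] /= rw; case: ifPn => [_|ba]; first exact: reduced_behead rw.
by rewrite /reduced /= ba.
Qed.

Lemma wmul_reduced w1 w2 : reduced w2 -> reduced (wmul w1 w2).
Proof. by move=> rw2; elim: w1 => //= a w1 /wcons_reduced. Qed.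

Lemma wcons_id a w : reduced (a :: w) -> wcons a w = a :: w.
Proof. by case: w => [//|b w] /= /andP[/negbTE ->]. Qed.

Lemma wconsK a w : reduced w -> wcons a (wcons (linv a) w) = w.
Proof.
case: w => [_|b w rw] /=; first by rewrite eqxx.
by rewrite linvK; case: eqP => [ba|_] /=; [rewrite -ba wcons_id|rewrite eqxx].
Qed.

Lemma wmul_cons a w1 w2 : reduced w2 ->
  wmul (wcons a w1) w2 = wcons a (wmul w1 w2).
Proof.
move=> rw2; case: w1 => [//|b w1] /=; case: eqP => [->|//].
by rewrite wconsK ?wmul_reduced.
Qed.

Lemma wmulA w1 w2 w3 : reduced w3 ->
  wmul w1 (wmul w2 w3) = wmul (wmul w1 w2) w3.
Proof. by move=> rw3; elim: w1 => //= a w1 ->; rewrite wmul_cons. Qed.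

Lemma wmulw1 w : reduced w -> wmul w [::] = w.
Proof.
by elim: w => //= a w IHw raw; rewrite IHw ?wcons_id ?(reduced_behead raw).
Qed.

Lemma winvK : involutive winv.
Proof. by move=> w; rewrite /winv map_rev revK mapK //; exact: linvK. Qed.

Lemma winv_reduced w : reduced w -> reduced (winv w).
Proof.
rewrite /reduced /winv rev_sorted sorted_map; apply: sub_sorted => a b /=.
by apply: contraNN => /eqP ->; rewrite linvK.
Qed.

Lemma wmulVw w : wmul (winv w) w = [::].
Proof.
elim: w => //= a w IHw; rewrite /winv /= rev_cons /wmul foldr_rcons /=.
by rewrite linvK eqxx.
Qed.

End ReducedWords.

Record freegroup (r : nat) :=
  FreeGroup { word : seq (letter r); wordP : reduced word }.

HB.instance Definition _ (r : nat) := [isSub for @word r].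
HB.instance Definition _ (r : nat) := [Choice of freegroup r by <:].

Section FreeGroup.
Variable r : nat.
Implicit Types g h : freegroup r.

Definition fg_one : freegroup r := @FreeGroup r [::] isT.
Definition fg_inv g : freegroup r := FreeGroup (winv_reduced (wordP g)).
Definition fg_mul g h : freegroup r :=
  FreeGroup (wmul_reduced (word g) (wordP h)).

Lemma fg_mulA : associative fg_mul.
Proof. by move=> f g h; apply: val_inj; rewrite /= wmulA ?wordP. Qed.

Lemma fg_mul1 : left_id fg_one fg_mul.
Proof. by move=> g; apply: val_inj. Qed.

Lemma fg_mulr1 : right_id fg_one fg_mul.
Proof. by move=> g; apply: val_inj; rewrite /= wmulw1 ?wordP. Qed.

Lemma fg_mulV : left_inverse fg_one fg_inv fg_mul.
Proof. by move=> g; apply: val_inj; rewrite /= wmulVw. Qed.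

Lemma fg_mulrV : right_inverse fg_one fg_inv fg_mul.
Proof.
by move=> g; apply: val_inj; rewrite /= -{1}[word g]winvK wmulVw.
Qed.

HB.instance Definition _ := isGroup.Build (freegroup r)
  fg_mulA fg_mul1 fg_mulr1 fg_mulV fg_mulrV.

Definition word_length g : nat := size (word g).

End FreeGroup.

#[short(type="completeMetricType")]
HB.structure Definition CompleteMetric (R : numDomainType) :=
  { X of Metric R X & Complete X }.

Record isom (R : realType) (X : metricType R) := Isom {
  isom_fun :> X -> X;
  isom_mdist : forall x y, mdist (isom_fun x) (isom_fun y) = mdist x y;
  isom_surj : forall y, exists x, isom_fun x = y }.

Section Isom.
Variables (R : realType) (X : metricType R).
Implicit Types f g h : isom X.

HB.instance Definition _ := gen_eqMixin (isom X).
HB.instance Definition _ := gen_choiceMixin (isom X).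

Lemma isomP f g : f =1 g -> f = g.
Proof.
case: f g => [f fd fs] [g gd gs] /= /funext fg; subst g.
by congr Isom; exact: Prop_irrelevance.
Qed.

Lemma isom_inj f : injective f.
Proof.
by move=> x y fxy; apply: mdist_positivity; rewrite -(isom_mdist f) fxy mdistxx.
Qed.

Definition isom_one : isom X.
Proof. by exists id => // y; exists y. Defined.

Definition isom_mul f g : isom X.
Proof.
exists (f \o g) => [x y|y]; first by rewrite /= !isom_mdist.
by have [z <-] := isom_surj f y; have [x <-] := isom_surj g z; exists x.
Defined.

Lemma isom_surjK f y : f (sval (cid (isom_surj f y))) = y.
Proof. by case: cid. Qed.

Definition isom_inv f : isom X.
Proof.
exists (fun y => sval (cid (isom_surj f y))) => [x y|x].
  by rewrite -(isom_mdist f) !isom_surjK.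
by exists (f x); apply: (@isom_inj f); rewrite isom_surjK.
Defined.

Lemma isom_mulA : associative isom_mul.
Proof. by move=> f g h; apply: isomP. Qed.

Lemma isom_mul1 : left_id isom_one isom_mul.
Proof. by move=> f; apply: isomP. Qed.

Lemma isom_mulr1 : right_id isom_one isom_mul.
Proof. by move=> f; apply: isomP. Qed.

Lemma isom_mulrV : right_inverse isom_one isom_inv isom_mul.
Proof. by move=> f; apply: isomP => x /=; rewrite isom_surjK. Qed.

Lemma isom_mulV : left_inverse isom_one isom_inv isom_mul.
Proof.
by move=> f; apply: isomP => x /=; apply: (@isom_inj f); rewrite isom_surjK.
Qed.

HB.instance Definition _ := isGroup.Build (isom X)
  isom_mulA isom_mul1 isom_mulr1 isom_mulV isom_mulrV.

HB.instance Definition _ := Topological.copy (isom X)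
  (initial_topology (fun f : isom X => (f : {compact-open, X -> X}))).

End Isom.

(* The upper half-plane {z | Im z > 0} with the Poincare metric:
   cosh d(p, q) = 1 + |p - q|^2 / (2 Im p Im q). *)
Record hplane (R : realType) := HPlane {
  hre : R;
  him : R;
  him_gt0 : 0 < him }.

Definition arcosh (R : realType) (t : R) : R :=
  ln (t + Num.sqrt (t ^+ 2 - 1)).

Definition hdist (R : realType) (p q : hplane R) : R :=
  arcosh (1 + ((hre p - hre q) ^+ 2 + (him p - him q) ^+ 2)
              / (2 * him p * him q)).

Section CAT.
Variables (R : realType) (X : metricType R).

Definition geodesic (x y : X) (c : R -> X) : Prop :=
  [/\ c 0 = x, c (mdist x y) = y &
      {in `[0, mdist x y] &, forall s t, mdist (c s) (c t) = `|s - t|} ].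

Definition geodesic_space : Prop := forall x y : X, exists c, geodesic x y c.

(* A triangle has vertices v i and sides c i from v i to v (i + 1), i mod 3.
   The points p and q lie on the comparison sides [w i, w (i + 1)] and
   [w j, w (j + 1)], at the same distances from the endpoints as c i s and
   c j t; such points of the hyperbolic plane are unique. *)
Definition cat_m1 : Prop :=
  geodesic_space /\
  forall (v : 'I_3 -> X) (c : 'I_3 -> R -> X) (w : 'I_3 -> hplane R),
    (forall i, geodesic (v i) (v (ordS i)) (c i)) ->
    (forall i j, hdist (w i) (w j) = mdist (v i) (v j)) ->
    forall (i j : 'I_3) (s t : R) (p q : hplane R),
      0 <= s <= mdist (v i) (v (ordS i)) ->
      0 <= t <= mdist (v j) (v (ordS j)) ->
      hdist (w i) p = s ->
      hdist p (w (ordS i)) = mdist (v i) (v (ordS i)) - s ->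
      hdist (w j) q = t ->
      hdist q (w (ordS j)) = mdist (v j) (v (ordS j)) - t ->
      mdist (c i s) (c j t) <= hdist p q.

End CAT.

Section Boundary.
Variables (R : realType) (X : metricType R) (o : X).

Definition gromov (x y z : X) : R :=
  (mdist x z + mdist y z - mdist x y) / 2.

Definition gromov_seq (u : nat -> X) : Prop :=
  gromov (u nm.1) (u nm.2) o @[nm --> (\oo, \oo)] --> +oo.

Definition gromov_equiv (u v : nat -> X) : Prop :=
  gromov (u n) (v n) o @[n --> \oo] --> +oo.

Record boundary := Boundary {
  bd_class :> set (nat -> X);
  bd_classP : exists2 u, gromov_seq u &
    bd_class = [set v | gromov_seq v /\ gromov_equiv u v] }.

(* The continuous extension to the boundary: the common limit, in [0, +oo],
   along all representing sequences. In a CAT(-1) space this limit exists;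
   elsewhere 0 is a default value. *)
Definition gromov_bd (xi zeta : boundary) : \bar R :=
  xget 0%E [set l : \bar R | forall u v, bd_class xi u -> bd_class zeta v ->
    (gromov (u n) (v n) o)%:E @[n --> \oo] --> l].

Definition visual_dist (xi zeta : boundary) : R :=
  fine (expeR (- gromov_bd xi zeta)%E).

End Boundary.

Arguments visual_dist {R X} o xi zeta.

Section Hausdorff.
Variables (R : realType) (T : Type) (d : T -> T -> R).
Local Open Scope ereal_scope.

(* The point 0 makes the diameter of the empty set 0 instead of -oo. *)
Definition diam (A : set T) : \bar R :=
  ereal_sup (0 |` [set (d xy.1 xy.2)%:E | xy in A `*` A]).

Definition hausdorff_premeasure (s delta : R) (A : set T) : \bar R :=
  ereal_inf [set \sum_(0 <= i <oo) (diam (U i) `^ s) | U in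
    [set U : nat -> set T |
      A `<=` \bigcup_i U i /\ forall i, diam (U i) <= delta%:E]].

Definition hausdorff_measure (s : R) (A : set T) : \bar R :=
  ereal_sup [set hausdorff_premeasure s delta A |
    delta in [set delta : R | (0 < delta)%R]].

(* If the s-dimensional measure vanishes, so does the t-dimensional one for
   t > s; hence excluding s = 0 does not change the infimum, and it avoids a
   convention for 0^0. *)
Definition hausdorff_dim (A : set T) : \bar R :=
  ereal_inf [set s%:E | s in
    [set s : R | (0 < s)%R /\ hausdorff_measure s A = 0]].

End Hausdorff.

Section Representations.
Variables (R : realType) (X : metricType R) (o : X) (r : nat).
Variable rho : {multiplicative freegroup r -> isom X}.

Definition orbit_map (g : freegroup r) : X := rho g o.

Definition schottky : Prop :=
  exists2 K : R, 1 <= K & forall g h : freegroup r,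
    let l := (word_length (g^-1 * h)%g)%:R in
    K^-1 * l - K <= mdist (orbit_map g) (orbit_map h) <= K * l + K.

(* A sequence of X converges to a boundary point exactly when it belongs to
   the class of that point. *)
Definition limit_set : set (boundary o) :=
  [set xi | exists g : nat -> freegroup r, bd_class xi (orbit_map \o g)].

End Representations.

Arguments limit_set {R X} o {r} rho.

(* Main.v *)
Require Import Defs.
From mathcomp Require Import all_boot all_order all_algebra.
From mathcomp Require Import all_classical all_reals all_analysis.
From mathcomp Require Import ring lra zify.
Import numFieldNormedType.Exports.

Set Implicit Arguments.
Unset Strict Implicit.
Unset Printing Implicit Defensive.

Import Order.TTheory GRing.Theory Num.Theory.

Local Open Scope classical_set_scope.
Local Open Scope ring_scope.

(** Write [L_k w] for the displacement of [o] by [Rep k w] and [L_oo w] for its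
    displacement by [Rep_oo w], and [(g|h)_k], [(g|h)_oo] for the Gromov products
    at [o] of the points of the two orbits that [g] and [h] label.  The idea is
    that for every [a < 1] and all large [k]
      [a (g|h)_oo - E <= (g|h)_k]  and  [a (g|h)_k - E <= (g|h)_oo]
    for all [g] and [h], with one constant [E].  The identity of the free group
    then induces a correspondence between the limit sets of [Rep k] and of
    [Rep_oo] that is Hoelder of exponent [a] for the visual distances in both
    directions, so the two dimensions differ at most by the factor [a]; letting
    [a] tend to 1 gives the limit.

    The comparison of the products rests on one uniform estimate.  Let the
    cancellation of two words [u] and [v] with [uv] reduced be
    [(L u + L v - L (uv)) / 2], the Gromov product of [u^-1 o] and [v o].  If it
    is bounded by some [C] for both actions, then [L] is additive up to [2 C] on
    each concatenation.  Cutting a word into blocks of length [N], and taking [k]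
    so large that [L_k] and [L_oo] differ by at most 1 on the finitely many words
    of length at most [N], shows that they differ by [O(1 + length / N)] on all
    reduced words, which is a small multiple of [L_oo] plus a constant because
    [Rep_oo] is Schottky.  Moreover [(g|h)] is, up to [2 C], the displacement of
    the longest common prefix of [g] and [h], so the Gromov products inherit the
    comparison ([gromov_orbit_compare]).

    The bound [C] comes from two facts about hyperbolic spaces.  A word of length
    at most [2^j] traces under [Rep_oo] a quasi-geodesic, whose points see its two
    ends with a Gromov product that grows at most linearly in [j]
    ([quasi_geodesic_center]).  Since the displacement of a block of length [2^j]
    grows like [2^j], for some [j] the cancellations between consecutive blocks
    are tiny compared with the lengths of the blocks.  This is a condition on
    finitely many words, so it passes to [Rep k] for large [k], and
    hyperbolicity propagates it from blocks to all words
    ([cancellation_le], [bounded_cancellation_stable]).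

    The curvature condition enters only through the comparison of a triangle
    with a point on one of its sides, written as a hyperbolic Stewart inequality
    ([cat_m1_stewart]).  It yields the four-point condition of Gromov
    ([cat_m1_hyperbolic]) and the convergence of Gromov products along sequences
    that tend to boundary points ([gromov_bd_cvg]); the latter makes the visual
    distance of two limit points the limit of [expR (- (g_n|h_n))] along the
    orbit. *)

(** * Hyperbolic functions *)

Section HyperbolicFunctions.
Variable R : realType.
Implicit Types x y t : R.

Definition ch x : R := (expR x + expR (- x)) / 2.
Definition sh x : R := (expR x - expR (- x)) / 2.

Lemma chN x : ch (- x) = ch x.
Proof. by rewrite /ch opprK addrC. Qed.

Lemma ch_norm x : ch `|x| = ch x.
Proof. by case: (ger0P x) => // _; rewrite chN. Qed.

Lemma sh0 : sh 0 = 0.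
Proof. by rewrite /sh oppr0 subrr mul0r. Qed.

Lemma sh_ge0 x : 0 <= x -> 0 <= sh x.
Proof. by move=> x0; rewrite divr_ge0// subr_ge0 ler_expR; lra. Qed.

Lemma sh_gt0 x : 0 < x -> 0 < sh x.
Proof. by move=> x0; rewrite divr_gt0// subr_gt0 ltr_expR; lra. Qed.

Lemma chD x y : ch (x + y) = ch x * ch y + sh x * sh y.
Proof.
rewrite /ch /sh opprD !expRD !expRN.
have := expR_eq0 x; have := expR_eq0 y.
by move=> /negbT ? /negbT ?; field; apply/andP.
Qed.

Lemma chB x y : ch (x - y) = ch x * ch y - sh x * sh y.
Proof. by rewrite chD chN /sh opprK; field. Qed.

Lemma shB x y : sh (x - y) = sh x * ch y - ch x * sh y.
Proof.
rewrite /ch /sh opprB !expRD !expRN.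
have := expR_eq0 x; have := expR_eq0 y.
by move=> /negbT ? /negbT ?; field; apply/andP.
Qed.

Lemma ch2 x : ch x ^+ 2 = 1 + sh x ^+ 2.
Proof.
have := chB x x; rewrite subrr {1}/ch oppr0 expR0 => h.
by apply/eqP; rewrite -subr_eq0; apply/eqP; lra.
Qed.

Lemma ch_ge1 x : 1 <= ch x.
Proof.
have := ch2 x; have := sqr_ge0 (sh x).
have : 0 <= ch x by rewrite divr_ge0// addr_ge0// expR_ge0.
by nra.
Qed.

Lemma le_ch x y : 0 <= x -> x <= y -> ch x <= ch y.
Proof.
move=> x0 xy; have -> : y = x + (y - x) by lra.
rewrite chD; have := ch_ge1 (y - x); have := ch_ge1 x.
have := sh_ge0 x0; have : 0 <= sh (y - x) by rewrite sh_ge0; lra.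
by nra.
Qed.

Lemma ch_expR x : expR x = ch x + sh x.
Proof. by rewrite /ch /sh; field. Qed.

Lemma expR_le_ch x : expR x <= 2 * ch x.
Proof. by rewrite /ch; have := expR_gt0 (- x); lra. Qed.

Lemma ch_le_expR x : 0 <= x -> ch x <= expR x.
Proof. by move=> /sh_ge0; rewrite ch_expR; lra. Qed.

Lemma arcosh_ch t : 0 <= t -> arcosh (ch t) = t.
Proof.
move=> t0; rewrite /arcosh ch2 addrAC subrr add0r sqrtr_sqr ger0_norm ?sh_ge0//.
by rewrite -ch_expR expRK.
Qed.

Lemma ch_arcosh t : 1 <= t -> ch (arcosh t) = t.
Proof.
move=> t1; set q := Num.sqrt (t ^+ 2 - 1).
have q0 : 0 <= q by exact: sqrtr_ge0.
have q2 : q ^+ 2 = t ^+ 2 - 1 by rewrite sqr_sqrtr//; nra.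
have tq0 : 0 < t + q by lra.
rewrite /ch /arcosh expRN lnK ?posrE// -/q.
suff -> : (t + q)^-1 = t - q by field.
by apply/(mulfI (lt0r_neq0 tq0)); rewrite divff ?gt_eqF//; nra.
Qed.

Lemma sh_le_expM (s t : R) : 0 <= s <= t -> sh s <= expR (s - t) * sh t.
Proof.
move=> /andP[s0 st]; rewrite /sh mulrA ler_pM2r ?invr_gt0//.
rewrite mulrBr -!expRD; apply: lerB; first by rewrite ler_expR; lra.
by rewrite ler_expR; lra.
Qed.

Lemma sqr_le_ch (d : R) : 0 <= d -> d ^+ 2 / 8 <= ch d - 1.
Proof.
move=> d0; set h := d / 2; have -> : d = h + h by rewrite /h; field.
have h0 : 0 <= h by rewrite /h; lra.
rewrite chD -!expr2 ch2.
have : h <= 2 * sh h.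
  rewrite /sh; have := expR_ge1Dx h; have : expR (- h) <= 1 by rewrite expR_le1; lra.
  by lra.
by move=> ?; nra.
Qed.

End HyperbolicFunctions.

(** * The hyperbolic plane and the comparison inequality *)

Section HyperbolicPlane.
Variable R : realType.
Implicit Types p q : hplane R.

Lemma hdist_arg_ge1 p q :
  1 <= 1 + ((hre p - hre q) ^+ 2 + (him p - him q) ^+ 2) / (2 * him p * him q).
Proof.
rewrite lerDl divr_ge0 ?addr_ge0 ?sqr_ge0// !mulr_ge0//; exact/ltW/him_gt0.
Qed.

Lemma ch_hdist p q :
  ch (hdist p q) = (hre p ^+ 2 + hre q ^+ 2 + him p ^+ 2 + him q ^+ 2
                    - 2 * hre p * hre q) / (2 * him p * him q).
Proof.
rewrite ch_arcosh ?hdist_arg_ge1//.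
have := him_gt0 p; have := him_gt0 q => /lt0r_neq0 ? /lt0r_neq0 ?.
by field; apply/andP.
Qed.

Lemma hdist_eq p q (d : R) : 0 <= d -> ch (hdist p q) = ch d -> hdist p q = d.
Proof.
by move=> d0 h; rewrite -[RHS]arcosh_ch// -h ch_arcosh ?hdist_arg_ge1.
Qed.

Lemma hdist_sym p q : hdist p q = hdist q p.
Proof. by rewrite /hdist; congr arcosh; congr (_ + _ / _); ring. Qed.

Lemma hdistxx p : hdist p p = 0.
Proof.
apply: hdist_eq => //; rewrite ch_hdist /ch oppr0 expR0.
have /lt0r_neq0 ? := him_gt0 p; by field.
Qed.

Definition vert (t : R) : hplane R := @HPlane R 0 (expR t) (expR_gt0 t).

Lemma hdist_vert (s t : R) : s <= t -> hdist (vert s) (vert t) = t - s.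
Proof.
move=> st; apply: hdist_eq; first by lra.
rewrite ch_hdist /= /ch opprB !expRB.
have /negbT ? := expR_eq0 s; have /negbT ? := expR_eq0 t.
by field; apply/andP.
Qed.

Lemma ch_hdist_vert (s : R) q :
  ch (hdist (vert s) q) =
  ((hre q ^+ 2 + him q ^+ 2) * expR (- s) + expR s) / (2 * him q).
Proof.
rewrite ch_hdist /= expRN.
have /negbT ? := expR_eq0 s; have /lt0r_neq0 ? := him_gt0 q.
by field; apply/andP.
Qed.

(** One side lies on the imaginary axis, from [vert 0] to [vert l].  For
    [q = (u, v)] the two remaining conditions are linear in [P = 1 / (2 v)] and
    [Q = (u^2 + v^2) / (2 v)], and the solution comes from a point of the upper
    half-plane when [P > 0] and [4 P Q >= 1]; the latter says that
    [(ch (a + b) - ch l) * (ch l - ch (a - b)) >= 0], that is, the triangle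
    inequalities. *)
Lemma hplane_triangle (a b l : R) : 0 < l -> 0 <= a -> 0 <= b ->
  l <= a + b -> a <= l + b -> b <= l + a ->
  exists q, hdist (vert 0) q = b /\ hdist (vert l) q = a.
Proof.
move=> l0 a0 b0 lab alb bla.
pose P := (ch a - expR (- l) * ch b) / (2 * sh l).
pose Q := (expR l * ch b - ch a) / (2 * sh l).
have shl := sh_gt0 l0.
have PQ : P + Q = ch b.
  by rewrite /P /Q -mulrDl addrC addrA subrK; rewrite /sh in shl *; field;
     apply: lt0r_neq0; lra.
have PQl : Q * expR (- l) + P * expR l = ch a.
  rewrite /P /Q /sh expRN; have /negbT e0 := expR_eq0 l; field.
  rewrite e0 /=; move: shl; rewrite /sh expRN => shl; apply/eqP => h.
  have : 0 < (expR l - (expR l)^-1) / 2 * expR l by rewrite mulr_gt0 ?expR_gt0.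
  rewrite mulrAC mulrBl mulVf//; move/eqP: h.
  by move=> /eqP h; rewrite -expr2; nra.
have ea := ch_le_expR a0.
have P0 : 0 < P.
  rewrite /P; apply: divr_gt0; last by move: shl; clear; lra.
  rewrite subr_gt0.
  apply: (@lt_le_trans _ _ (ch (b - l))).
    rewrite /ch opprB !expRB !expRN -subr_gt0.
    have e1 : 1 < expR l by rewrite expR_gt1.
    have eb := expR_gt0 b.
    have -> : (expR b / expR l + expR l / expR b) / 2
       - (expR l)^-1 * ((expR b + (expR b)^-1) / 2)
       = (expR l ^+ 2 - 1) / (2 * expR l * expR b).
      by field; rewrite !gt_eqF ?expR_gt0.
    by rewrite divr_gt0 ?mulr_gt0 ?expR_gt0// subr_gt0; nra.
  by rewrite -ch_norm le_ch// ler_norml; apply/andP; split; lra.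
have PQ1 : 1 <= 4 * P * Q.
  have -> : 4 * P * Q = 1 + (ch (a + b) - ch l) * (ch l - ch (a - b)) / sh l ^+ 2.
    have s2 : sh l ^+ 2 = ch l ^+ 2 - 1 by rewrite ch2; ring.
    have el : expR (- l) = ch l - sh l by rewrite /ch /sh; field.
    have -> : 4 * P * Q =
       (ch a - expR (- l) * ch b) * (expR l * ch b - ch a) / sh l ^+ 2.
      by rewrite /P /Q; field; rewrite gt_eqF.
    rewrite chD chB el ch_expR.
    apply/(mulIf (lt0r_neq0 (exprn_gt0 2 shl))).
    rewrite [RHS]mulrDl mul1r !divfK ?gt_eqF ?exprn_gt0//.
    have ha := ch2 a; have hb := ch2 b.
    transitivity (2 * ch a * ch b * ch l - ch a ^+ 2
       - ch b ^+ 2 * (ch l ^+ 2 - sh l ^+ 2)); first by ring.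
    transitivity (sh l ^+ 2 + (2 * ch a * ch b * ch l - ch l ^+ 2
       - (ch a ^+ 2 * ch b ^+ 2 - sh a ^+ 2 * sh b ^+ 2))); last by ring.
    have -> : sh b ^+ 2 = ch b ^+ 2 - 1 by rewrite hb; ring.
    have -> : sh a ^+ 2 = ch a ^+ 2 - 1 by rewrite ha; ring.
    by rewrite s2; ring.
  rewrite lerDl divr_ge0 ?sqr_ge0// mulr_ge0// subr_ge0.
    by rewrite le_ch// ltW.
  by rewrite -ch_norm le_ch// ler_norml; apply/andP; split; lra.
pose v := (2 * P)^-1.
have v0 : 0 < v by rewrite invr_gt0 mulr_gt0.
pose u := Num.sqrt (Q / P - v ^+ 2).
have u2 : u ^+ 2 = Q / P - v ^+ 2.
  rewrite sqr_sqrtr// subr_ge0 (_ : Q / P = 4 * P * Q * v ^+ 2).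
    by rewrite ler_peMl// sqr_ge0.
  by rewrite /v; field; rewrite gt_eqF.
exists (@HPlane R u v v0); split; apply: hdist_eq => //.
- rewrite ch_hdist_vert /= u2 oppr0 expR0 subrK -PQ /v.
  by field; rewrite gt_eqF.
- rewrite ch_hdist_vert /= u2 subrK -PQl /v.
  by field; rewrite gt_eqF.
Qed.

End HyperbolicPlane.

Section Stewart.
Variables (R : realType) (X : metricType R).
Hypothesis Xcat : cat_m1 X.

(** In the hyperbolic plane this is an equality, the analogue of Stewart's theorem
    for a cevian.  All later uses of curvature go through this inequality, which
    compares a vertex with a point of the opposite side. *)
Lemma cat_m1_stewart (x y z : X) (c : R -> X) (s : R) :
  geodesic x y c -> 0 <= s <= mdist x y ->
  ch (mdist (c s) z) * sh (mdist x y) <=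
  ch (mdist x z) * sh (mdist x y - s) + ch (mdist y z) * sh s.
Proof.
move=> gc s01; set l := mdist x y in s01 *.
have [s0 sl] : 0 <= s /\ s <= l by apply/andP.
have := mdist_ge0 x y; rewrite -/l le_eqVlt => /orP[/eqP l0|l0].
  have -> : s = 0 by lra.
  by rewrite subr0 -l0 sh0 !mulr0 addr0.
set b := mdist x z; set a := mdist y z.
have [q [q0 ql]] : exists q, hdist (vert 0) q = b /\ hdist (vert l) q = a.
  apply: hplane_triangle; rewrite ?mdist_ge0 ?l0//.
  - by rewrite addrC /a [mdist y z]metric_sym; exact: metric_triangle.
  - by rewrite /l [mdist x y]metric_sym; exact: metric_triangle.
  - exact: metric_triangle.
have [geo cmp] := Xcat.
have [c1 gc1] := geo y z; have [c2 gc2] := geo z x.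
pose v (i : 'I_3) := nth x [:: x; y; z] i.
pose cc (i : 'I_3) := nth c [:: c; c1; c2] i.
pose w (i : 'I_3) := nth q [:: vert 0; vert l; q] i.
have gcc i : geodesic (v i) (v (ordS i)) (cc i).
  by case: i => [[|[|[|]]]].
have hw i j : hdist (w i) (w j) = mdist (v i) (v j).
  case: i j => [[|[|[|//]]] i3] [[|[|[|//]]] j3]; rewrite /w /v /= ?hdistxx ?mdistxx//.
  - by rewrite hdist_vert ?subr0// ltW.
  - by rewrite hdist_sym hdist_vert ?subr0 ?ltW// metric_sym.
  - by rewrite hdist_sym q0 metric_sym.
  - by rewrite hdist_sym ql metric_sym.
pose i0 := @Ordinal 3 0 isT; pose i2 := @Ordinal 3 2 isT.
have := cmp v cc w gcc hw i0 i2 s 0 (vert s) q.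
rewrite /v /cc /w /= -/l s01 lexx mdist_ge0 hdistxx.
have [-> _ _] := gc2.
rewrite !hdist_vert// ?subr0 => /(_ isT isT erefl erefl erefl).
rewrite hdist_sym q0 metric_sym => /(_ erefl) le.
have shl := sh_gt0 l0.
apply: (@le_trans _ _ (ch (hdist (vert s) q) * sh l)).
  by rewrite ler_pM2r// le_ch// mdist_ge0.
rewrite -q0 -ql !ch_hdist_vert oppr0 expR0 /sh opprB !expRB !expRN.
have /negbT ? := expR_eq0 s; have /negbT ? := expR_eq0 l.
have /lt0r_neq0 ? := him_gt0 q.
rewrite le_eqVlt; apply/orP; left; apply/eqP; field; do ?[apply/andP; split] => //.
Qed.

End Stewart.

(** * Gromov products and hyperbolicity *)

Section GromovProduct.
Variables (R : realType) (X : metricType R).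
Implicit Types x y z o : X.

Lemma gromov_ge0 x y z : 0 <= gromov x y z.
Proof.
by rewrite divr_ge0// subr_ge0 [mdist y z]metric_sym metric_triangle.
Qed.

Lemma gromovC x y z : gromov x y z = gromov y x z.
Proof. by rewrite /gromov [mdist y x]metric_sym [mdist y z + _]addrC. Qed.

Lemma gromov_le_mdist x y z : gromov x y z <= mdist x z.
Proof.
rewrite /gromov; have := metric_triangle x z y; have := metric_triangle y x z.
by rewrite [mdist y x]metric_sym; lra.
Qed.

Lemma gromov_le_mdistr x y z : gromov x y z <= mdist y z.
Proof. by rewrite gromovC gromov_le_mdist. Qed.

(** Quantifying over the lower bound [t] avoids a minimum in the four-point
    condition. *)
Definition hyperbolic (delta : R) : Prop := forall x y z o (t : R),
  t <= gromov x y o -> t <= gromov y z o -> t - delta <= gromov x z o.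

(** The way in which the four-point condition is used below: of the three products
    of a triple, the two smallest differ by at most [delta]. *)
Lemma hyperbolic_le (delta : R) (A : R) x y z o : hyperbolic delta ->
  gromov x z o <= A -> A + delta < gromov x y o -> gromov y z o <= A + delta.
Proof.
move=> hyp xz xy; rewrite leNgt; apply/negP => yz.
have [h|h] := leP (gromov x y o) (gromov y z o).
  by have := hyp _ _ _ _ _ (lexx _) h; lra.
by have := hyp _ _ _ _ _ (ltW h) (lexx _); lra.
Qed.

Lemma geodesic_mdistl x y c t : geodesic x y c -> 0 <= t <= mdist x y ->
  mdist x (c t) = t.
Proof.
move=> [c0 _ h] /andP[t0 tl]; rewrite -{1}c0.
by rewrite h ?in_itv/= ?lexx ?mdist_ge0 ?t0// sub0r normrN ger0_norm.
Qed.

Lemma geodesic_mdistr x y c t : geodesic x y c -> 0 <= t <= mdist x y ->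
  mdist (c t) y = mdist x y - t.
Proof.
move=> [_ cl h] /andP[t0 tl]; rewrite -{1}cl.
rewrite h ?in_itv/= ?lexx ?mdist_ge0 ?t0//.
by rewrite distrC ger0_norm// subr_ge0.
Qed.

End GromovProduct.

Section CatGeometry.
Variables (R : realType) (X : metricType R).
Hypothesis Xcat : cat_m1 X.
Implicit Types x y z o : X.

(** Two geodesics from [o] stay together up to the time [gromov x y o], and are
    exponentially close well before it.  Applying [cat_m1_stewart] on each of the
    two sides in turn bounds the distance of [cx t] and [cy t] by its value in the
    comparison triangle, where
    [ch d = 1 + sh t ^+ 2 * (ch c - ch (a - b)) / (sh a * sh b)] for sides
    [a], [b] and [c = mdist x y]. *)
Lemma cat_m1_thin o x y cx cy (t : R) : geodesic o x cx -> geodesic o y cy ->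
  0 <= t -> t <= mdist o x -> t <= mdist o y ->
  ch (mdist (cx t) (cy t)) <= 1 + expR (2 * (t - gromov x y o)).
Proof.
move=> gx gy; rewrite le_eqVlt => /orP[/eqP <- _ _|t0 tx ty].
  have [-> _ _] := gx; have [-> _ _] := gy.
  by rewrite mdistxx /ch oppr0 expR0; have := expR_gt0 (2 * (0 - gromov x y o)); lra.
have t0x : 0 <= t <= mdist o x by rewrite (ltW t0).
have t0y : 0 <= t <= mdist o y by rewrite (ltW t0).
have := cat_m1_stewart Xcat (cx t) gy t0y.
have := cat_m1_stewart Xcat y gx t0x.
rewrite (geodesic_mdistl gx t0x) [mdist y (cx t)]metric_sym.
rewrite [mdist (cy t) _]metric_sym.
have := sh_le_expM t0x; have := sh_le_expM t0y.
rewrite /gromov [mdist x o]metric_sym [mdist y o]metric_sym.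
set a := mdist o x in tx t0x *; set b := mdist o y in ty t0y *.
set c := mdist x y; set d := mdist (cx t) (cy t) => htb hta h1 h2.
have sa : 0 < sh a by rewrite sh_gt0//; lra.
have sb : 0 < sh b by rewrite sh_gt0//; lra.
have st : 0 < sh t by rewrite sh_gt0.
have key : ch d * sh b * sh a <= sh b * sh a + sh t ^+ 2 * (ch c - ch (a - b)).
  apply: (@le_trans _ _ (ch t * sh (b - t) * sh a
      + (ch b * sh (a - t) + ch c * sh t) * sh t)).
    apply: le_trans (_ : (ch t * sh (b - t) + ch (mdist (cx t) y) * sh t) * sh a <= _).
      by rewrite ler_pM2r.
    rewrite mulrDl lerD2l mulrAC ler_pM2r//.
  rewrite !shB chB le_eqVlt; apply/orP; left; apply/eqP.
  apply/eqP; rewrite -subr_eq0; apply/eqP.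
  transitivity ((ch t ^+ 2 - 1 - sh t ^+ 2) * sh a * sh b); first by ring.
  by rewrite ch2; ring.
have sab : 0 < sh b * sh a by rewrite mulr_gt0.
rewrite -(ler_pM2r sab) mulrA; apply: (le_trans key).
rewrite mulrDl mul1r lerD2l.
apply: (@le_trans _ _ (sh t ^+ 2 * expR c)).
  apply: ler_wpM2l; first exact: sqr_ge0.
  have := ch_ge1 (a - b); have : ch c <= expR c by rewrite ch_le_expR ?mdist_ge0.
  by lra.
rewrite (_ : 2 * _ = (t - a) + (t - b) + c); last by field.
rewrite !expRD expr2 mulrAC [leRHS](_ : _ =
  (expR (t - a) * sh a) * (expR (t - b) * sh b) * expR c); last first.
  by rewrite !expRD; ring.
rewrite mulrAC ler_pM2r ?expR_gt0//.
by apply: ler_pM => //; exact: ltW.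
Qed.

(** By [cat_m1_thin] the hyperbolic cosine of the distance is at most 2, so the
    distance is at most [ln 4 < 2]. *)
Lemma cat_m1_tripod o x y cx cy (t : R) : geodesic o x cx -> geodesic o y cy ->
  0 <= t -> t <= gromov x y o -> mdist (cx t) (cy t) <= 2.
Proof.
move=> gx gy t0 txy.
have tx : t <= mdist o x by rewrite metric_sym (le_trans txy)// gromov_le_mdist.
have ty : t <= mdist o y by rewrite metric_sym (le_trans txy)// gromov_le_mdistr.
have := cat_m1_thin gx gy t0 tx ty => h.
have h1 : expR (2 * (t - gromov x y o)) <= 1 by rewrite expR_le1; lra.
rewrite -ler_expR (le_trans (expR_le_ch _))//.
have := expR_ge1Dx (1 : R); have := expRD (1 : R) 1.
have -> : 1 + 1 = 2 :> R by ring.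
by move=> -> ?; nra.
Qed.

(** Up to time [t] the geodesics from [o] to [x], [y] and [z] stay within distance
    2 of each other, so the path from [x] to [z] through the points at time [t] on
    the outer two is almost as short as the four-point condition requires. *)
Lemma cat_m1_hyperbolic : hyperbolic X 2.
Proof.
move=> x y z o t txy tyz.
have [t0|t0] := ltP t 0; first by have := gromov_ge0 x z o; lra.
have [geo _] := Xcat.
have [cx gx] := geo o x; have [cy gy] := geo o y; have [cz gz] := geo o z.
have hxy := cat_m1_tripod gx gy t0 txy; have hyz := cat_m1_tripod gy gz t0 tyz.
have t0x : 0 <= t <= mdist o x.
  by rewrite t0 metric_sym (le_trans txy)// gromov_le_mdist.
have t0z : 0 <= t <= mdist o z.
  by rewrite t0 metric_sym (le_trans tyz)// gromov_le_mdistr.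
have := geodesic_mdistr gx t0x; have := geodesic_mdistr gz t0z.
have := metric_triangle (cx t) (cy t) (cz t).
have := metric_triangle x (cx t) z; have := metric_triangle (cx t) (cz t) z.
rewrite [mdist x (cx t)]metric_sym /gromov [mdist x o]metric_sym.
by rewrite [mdist z o]metric_sym; lra.
Qed.

(** Once [t] exceeds [gromov x y o], the point at time [t] on the geodesic from [o]
    to [x] almost lies on a geodesic from [x] to [y]: the triangle inequality
    [mdist x y <= mdist x (cx t) + mdist (cx t) y] is then nearly an equality. *)
Lemma cat_m1_shortcut o x y cx (t : R) : geodesic o x cx -> 0 < t <= mdist o x ->
  mdist (cx t) y <= mdist x y - (mdist o x - t)
    + (expR (- 2 * mdist x y) + 2 * expR (2 * (gromov x y o - t))).
Proof.
move=> gx /andP[t0 tx]; have t0x : 0 <= t <= mdist o x by rewrite (ltW t0).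
have := cat_m1_stewart Xcat y gx t0x.
have := sh_le_expM t0x.
have : sh (mdist o x - t) <= expR (mdist o x - t - mdist o x) * sh (mdist o x).
  by apply: sh_le_expM; apply/andP; split; lra.
rewrite /gromov [mdist x o]metric_sym [mdist y o]metric_sym.
have b0 := mdist_ge0 o y; have c0 := mdist_ge0 x y.
set a := mdist o x in tx t0x *; set b := mdist o y in b0 *.
set c := mdist x y in c0 *; set d := mdist (cx t) _ => h1 h2 h3.
have sa : 0 < sh a by rewrite sh_gt0//; lra.
have h4 : ch d <= ch b * expR (- t) + ch c * expR (t - a).
  rewrite -(ler_pM2r sa) (le_trans h3)// mulrDl -!mulrA.
  have cb := ch_ge1 b; have cc := ch_ge1 c.
  rewrite (_ : a - t - a = - t) in h1; last by ring.
  by apply: lerD; apply: ler_wpM2l => //; lra.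
rewrite -ler_expR (le_trans (expR_le_ch _))//.
rewrite expRD; apply: le_trans (_ : expR (c - (a - t)) *
   (1 + (expR (- 2 * c) + 2 * expR (2 * ((a + b - c) / 2 - t)))) <= _); last first.
  by rewrite ler_pM2l ?expR_gt0// expR_ge1Dx.
rewrite [leRHS]mulrDr mulr1 [X in _ + X]mulrDr -expRD [X in _ + (_ + X)]mulrCA -expRD.
rewrite (_ : c - (a - t) + 2 * _ = b - t); last by field.
apply: le_trans (ler_wpM2l _ h4) _; first by [].
rewrite mulrDr [X in X <= _]addrC.
rewrite (_ : 2 * (ch c * _) = expR (c - (a - t)) + expR (c - (a - t) + - 2 * c)).
  rewrite addrA; apply: lerD => //.
  by rewrite ler_pM2l// expRD ler_pM2r ?expR_gt0// ch_le_expR.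
rewrite /ch mulrA mulrCA mulfV// mulr1 mulrDl -!expRD.
by congr (expR _ + expR _); ring.
Qed.

End CatGeometry.

(** * Gromov products at infinity *)

Section GromovContinuity.
Variables (R : realType) (X : metricType R).
Hypothesis Xcat : cat_m1 X.
Implicit Types x y z o : X.

(** Let [t] be large compared with [M], and [T] large compared with [t].  By
    [cat_m1_shortcut] the product [gromov x y o] is, up to a small error, determined
    by the distance of [y] to the point at time [t] on the geodesic from [o] to
    [x].  By [cat_m1_thin] that point hardly moves when [x] is replaced by [x']. *)
Lemma cat_m1_gromov_continuous o (M e : R) : 0 <= M -> 0 < e ->
  exists T, forall x x' y, T <= gromov x x' o -> gromov x y o <= M ->
    `|gromov x y o - gromov x' y o| <= e.
Proof.
move=> M0 e0; pose q := ln (1 + 3 / e).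
have e3 : 0 < 3 / e by rewrite divr_gt0.
have q0 : 0 <= q by rewrite ln_ge0//; lra.
pose n := expR (- q).
have n0 : 0 < n := expR_gt0 _.
have n1 : n <= 1 by rewrite expR_le1; lra.
have ne : 3 * n <= e.
  rewrite /n expRN lnK ?posrE; last by lra.
  rewrite ler_pdivrMr; last by lra.
  by rewrite mulrDr mulr1 mulrC divfK ?gt_eqF//; lra.
have nn : expR (2 * - q) = n ^+ 2.
  by rewrite (_ : 2 * - q = - q + - q) ?expRD -?expr2//; ring.
clearbody q; pose t := M + 3 + q; exists (t + q + 1) => x x' y hT hM.
have hM' : gromov x' y o <= M + 3.
  rewrite leNgt; apply/negP => h.
  have := @cat_m1_hyperbolic _ _ Xcat x x' y o (M + 3) _ (ltW h).
  by move=> /(_ ltac:(rewrite /t in hT; lra)); lra.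
have [geo _] := Xcat.
have [cx gx] := geo o x; have [cx' gx'] := geo o x'.
have hx := gromov_le_mdist x x' o; have hx' := gromov_le_mdistr x x' o.
rewrite ![mdist _ o]metric_sym in hx hx'.
have t0 : 0 < t by rewrite /t; lra.
have tx : t <= mdist o x by lra.
have tx' : t <= mdist o x' by lra.
have t0x : 0 <= t <= mdist o x by rewrite ltW.
have t0x' : 0 <= t <= mdist o x' by rewrite ltW.
have d1 := geodesic_mdistl gx t0x; have d2 := geodesic_mdistr gx t0x.
have d1' := geodesic_mdistl gx' t0x'; have d2' := geodesic_mdistr gx' t0x'.
have := cat_m1_thin Xcat gx gx' (ltW t0) tx tx'.
set D := mdist (cx t) (cx' t) => hD.
have D0 : 0 <= D := mdist_ge0 _ _.
have D3n : D <= 3 * n.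
  have h : expR (2 * (t - gromov x x' o)) <= n ^+ 2.
    by rewrite -nn ler_expR; lra.
  by have := sqr_le_ch D0; nra.
have short z cz : geodesic o z cz -> t <= mdist o z -> gromov z y o <= M + 3 ->
  t + q + 1 <= mdist o z ->
  mdist (cz t) y <= mdist z y - (mdist o z - t) + 3 * n.
  move=> gz tz hz tqz; have := @cat_m1_shortcut _ _ Xcat o z y cz t gz.
  rewrite t0 tz => /(_ isT) /le_trans; apply; rewrite lerD2l.
  have h1 : expR (2 * (gromov z y o - t)) <= n ^+ 2.
    by rewrite -nn ler_expR /t; lra.
  have h2 : expR (-2 * mdist z y) <= n ^+ 2.
    rewrite -nn ler_expR; move: hz; rewrite /t in tqz; rewrite /gromov.
    rewrite [mdist z o]metric_sym [mdist y o]metric_sym.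
    have := metric_triangle o y z; rewrite [mdist y z]metric_sym.
    by lra.
  by nra.
have s1 := short x cx gx tx ltac:(lra) ltac:(lra).
have s2 := short x' cx' gx' tx' hM' ltac:(lra).
have l1 := metric_triangle x (cx t) y; have l2 := metric_triangle x' (cx' t) y.
rewrite [mdist x (cx t)]metric_sym in l1.
rewrite [mdist x' (cx' t)]metric_sym in l2.
have l3 := metric_triangle (cx t) (cx' t) y.
have l4 := metric_triangle (cx' t) (cx t) y.
rewrite [mdist (cx' t) (cx t)]metric_sym -/D in l4.
rewrite -/D in l3.
rewrite ler_norml /gromov [mdist x o]metric_sym [mdist x' o]metric_sym.
by apply/andP; split; lra.
Qed.

Lemma gromov_seqP o (u : nat -> X) : gromov_seq o u <->
  forall M, exists N, forall n m, (N <= n)%N -> (N <= m)%N ->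
    M <= gromov (u n) (u m) o.
Proof.
split=> [/cvgryPge h M|h]; last first.
  apply/cvgryPge => M; have [N hN] := h M.
  exists ([set n | (N <= n)%N], [set n | (N <= n)%N]); last first.
    by move=> [n m] [/= *]; exact: hN.
  by split; exists N.
have [[A B] [[N1 _ hA] [N2 _ hB]] AB] := h M.
exists (maxn N1 N2) => n m; rewrite !geq_max => /andP[n1 n2] /andP[m1 m2].
by apply: (AB (n, m)); split; [exact: hA|exact: hB].
Qed.

Lemma gromov_equivP o (u v : nat -> X) : gromov_equiv o u v <->
  forall M, exists N, forall n, (N <= n)%N -> M <= gromov (u n) (v n) o.
Proof.
split=> [/cvgryPge h M|h]; first by have [N _ hN] := h M; exists N.
by apply/cvgryPge => M; have [N hN] := h M; exists N.
Qed.

Lemma gromov_seq_equivxx o (u : nat -> X) : gromov_seq o u -> gromov_equiv o u u.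
Proof.
move=> /gromov_seqP h; apply/gromov_equivP => M.
by have [N hN] := h M; exists N => n Nn; exact: hN.
Qed.

Lemma bd_class_gromov o (xi : boundary o) u v : bd_class xi u -> bd_class xi v ->
  forall M, exists N, forall n m, (N <= n)%N -> (N <= m)%N ->
    M <= gromov (u n) (v m) o.
Proof.
have [w wseq ->] := bd_classP xi.
move=> [/gromov_seqP useq /gromov_equivP wu] [/gromov_seqP vseq /gromov_equivP wv] M.
have /gromov_seqP/(_ (M + 4)) [N1 h1] := wseq.
have [N2 h2] := wu (M + 4); have [N3 h3] := wv (M + 4).
exists (maxn N1 (maxn N2 N3)) => n m.
rewrite !geq_max => /and3P[n1 n2 n3] /and3P[m1 m2 m3].
have hyp := @cat_m1_hyperbolic _ _ Xcat.
have e1 : M + 4 <= gromov (u n) (w n) o by rewrite gromovC h2.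
have e2 := h1 _ _ n1 m1; have e3 := h3 _ m3.
have e4 := hyp _ _ _ _ _ e1 e2.
have e5 := hyp (u n) (w m) (v m) o (M + 2) ltac:(lra) ltac:(lra).
by lra.
Qed.

(** Either the products along one pair of representatives tend to infinity, and then
    by hyperbolicity so do those along every pair, or they are bounded by some [M]
    infinitely often.  In the second case hyperbolicity bounds all products of far
    members of the two classes, and [cat_m1_gromov_continuous] makes them a Cauchy
    family, with one limit for all representatives. *)
Lemma gromov_bd_cvg o (xi zeta : boundary o) u v :
  bd_class xi u -> bd_class zeta v ->
  (gromov (u n) (v n) o)%:E @[n --> \oo] --> gromov_bd xi zeta.
Proof.
suff /(xgetPex 0%E) H : exists l : \bar R, forall u v,
    bd_class xi u -> bd_class zeta v ->
    (gromov (u n) (v n) o)%:E @[n --> \oo] --> l by exact: H.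
have hyp := @cat_m1_hyperbolic _ _ Xcat.
have [u0 u0seq xiE] := bd_classP xi; have [v0 v0seq zetaE] := bd_classP zeta.
have u0xi : bd_class xi u0 by rewrite xiE; split=> //; exact: gromov_seq_equivxx.
have v0ze : bd_class zeta v0 by rewrite zetaE; split=> //; exact: gromov_seq_equivxx.
have [H|] := pselect (forall M, exists N, forall n, (N <= n)%N ->
  M <= gromov (u0 n) (v0 n) o).
  exists +oo%E => {}u {}v uxi vze; apply/cvgeyPge => M.
  have [N1 h1] := bd_class_gromov uxi u0xi (M + 4).
  have [N2 h2] := H (M + 4).
  have [N3 h3] := bd_class_gromov v0ze vze (M + 4).
  exists (maxn N1 (maxn N2 N3)) => // n /=; rewrite !geq_max => /and3P[n1 n2 n3].
  rewrite lee_fin.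
  have e1 := hyp _ _ _ _ _ (h1 _ _ n1 n1) (h2 _ n2).
  have := hyp (u n) (v0 n) (v n) o (M + 2) ltac:(lra).
  by have := h3 _ _ n3 n3 => e3 /(_ ltac:(lra)); lra.
move/existsNP => [M0 /forallNP HM0].
pose M := `|M0| + 5.
have M_ge0 : 0 <= M by rewrite /M; have := normr_ge0 M0; lra.
have bnd u' v' : bd_class xi u' -> bd_class zeta v' -> exists N, forall n m,
    (N <= n)%N -> (N <= m)%N -> gromov (u' n) (v' m) o <= M.
  move=> uxi vze.
  have [N1 h1] := bd_class_gromov u0xi uxi (M + 5).
  have [N2 h2] := bd_class_gromov v0ze vze (M + 5).
  exists (maxn N1 N2) => n m; rewrite !geq_max => /andP[n1 n2] /andP[m1 m2].
  rewrite leNgt; apply/negP => hlt.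
  have := HM0 (maxn N1 N2); move/existsNP => [k /not_implyP[]].
  rewrite geq_max => /andP[k1 k2] /negP; rewrite -ltNge => hk.
  have e1 := hyp (u0 k) (u' n) (v' m) o M
     ltac:(have := h1 _ _ k1 n1; lra) (ltW hlt).
  have e2 := hyp (u0 k) (v' m) (v0 k) o (M - 2) ltac:(lra)
     ltac:(have := h2 _ _ k2 m2; rewrite gromovC; lra).
  by have := ler_norm M0; rewrite /M in e2; lra.
have key u' v' : bd_class xi u' -> bd_class zeta v' ->
  forall e, 0 < e -> exists N, forall n m, (N <= n)%N -> (N <= m)%N ->
    `|gromov (u' n) (v' n) o - gromov (u0 m) (v0 m) o| <= e.
  move=> uxi vze e e0.
  have [T hT] := @cat_m1_gromov_continuous o M (e / 2) M_ge0 ltac:(lra).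
  have [N1 h1] := bnd _ _ uxi vze.
  have [N2 h2] := bnd _ _ u0xi vze.
  have [N3 h3] := bd_class_gromov uxi u0xi T.
  have [N4 h4] := bd_class_gromov vze v0ze T.
  exists (maxn (maxn N1 N2) (maxn N3 N4)) => n m.
  rewrite !geq_max => /andP[/andP[n1 n2] /andP[n3 n4]].
  move=> /andP[/andP[m1 m2] /andP[m3 m4]].
  have := hT _ _ _ (h3 _ _ n3 m3) (h1 _ _ n1 n1).
  have := hT _ _ (u0 m) (h4 _ _ n4 m4); rewrite gromovC.
  move=> /(_ (h2 _ _ m2 n2)); rewrite [gromov (v0 m) _ _]gromovC.
  rewrite !ler_norml => /andP[a1 a2] /andP[b1 b2].
  by apply/andP; split; lra.
pose a n := gromov (u0 n) (v0 n) o.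
have acvg : cvg (a @ \oo).
  apply/cauchy_cvgP; apply: cauchy_exP => e e0.
  have [N hN] := key _ _ u0xi v0ze (e / 2) ltac:(lra).
  exists (a N); exists N => //= n Nn.
  rewrite /ball/=; have := hN N n (leqnn N) Nn.
  by rewrite -/(a N) -/(a n); lra.
exists (lim (a @ \oo))%:E => u' v' uxi vze.
apply: cvg_EFin; first by near=> n.
apply/cvgrPdist_le => e e0.
have [N1 h1] := key _ _ uxi vze (e / 2) ltac:(lra).
have /cvgrPdist_le/(_ (e / 2)) := acvg => /(_ ltac:(lra)) [N2 _ h2].
exists (maxn N1 N2) => // n /=; rewrite geq_max => /andP[n1 n2].
have := h1 _ _ n1 n1; have := h2 _ n2; rewrite /= -/(a n).
rewrite !ler_norml => /andP[a1 a2] /andP[b1 b2].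
by apply/andP; split; lra.
Unshelve. all: by end_near.
Qed.

End GromovContinuity.

(** * Quasi-geodesics of bounded size *)

Section QuasiGeodesic.
Variables (R : realType) (X : metricType R) (delta : R).
Hypothesis delta_ge0 : 0 <= delta.
Hypothesis hyp : hyperbolic X delta.

(** Halving the chain [j] times costs [delta] each time.  The lower bound on the
    distances to [o] serves the chains with a single point. *)
Lemma gromov_chain o (t : R) j n (y : nat -> X) : (n <= 2 ^ j)%N ->
  (forall i, (i <= n)%N -> t <= mdist (y i) o) ->
  (forall i, (i < n)%N -> t <= gromov (y i) (y i.+1) o) ->
  t - delta * j%:R <= gromov (y 0%N) (y n) o.
Proof.
elim: j n y => [|j IHj] n y.
  rewrite expn0 mulr0 subr0; case: n => [_ h _|[_ _ h|//]]; last exact: h.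
  by have := h 0%N isT; rewrite /gromov mdistxx; lra.
move=> n2 yo yy; pose m := minn n (2 ^ j).
have mn : (m <= n)%N by rewrite geq_minl.
have h1 : t - delta * j%:R <= gromov (y 0%N) (y m) o.
  apply: IHj; first by rewrite geq_minr.
  - by move=> i im; apply: yo; exact: leq_trans im mn.
  - by move=> i im; apply: yy; exact: leq_trans im mn.
have h2 : t - delta * j%:R <= gromov (y m) (y n) o.
  have := IHj (n - m)%N (fun i => y (m + i)%N).
  rewrite addn0 subnKC//; apply.
  - by move: n2; rewrite expnS /m; lia.
  - by move=> i im; apply: yo; lia.
  - by move=> i im; rewrite addnS; apply: yy; lia.
rewrite -natr1 mulrDr mulr1 opprD addrA.
exact: hyp h1 h2.
Qed.

Lemma nat_switch (P : nat -> Prop) n : P 0%N -> P n \/ exists l, P l /\ ~ P l.+1.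
Proof.
move=> P0; elim: n => [|n [Pn|]]; [by left| |by right].
by have [Pn1|Pn1] := pselect (P n.+1); [left|right; exists n].
Qed.

Hypothesis geo : geodesic_space X.
Variable K : R.
Hypothesis K_ge1 : 1 <= K.

(** A bound on the distance of a geodesic to a quasi-geodesic of at most [2 ^ j] steps with
    the same ends; it grows with [j], which suffices because the block length [2 ^ j]
    grows faster. *)
Definition near_bound (j : nat) : R := K + delta * j%:R + 1.
Definition center_bound (j : nat) : R :=
  K * (K * (2 * near_bound j + 1 + K)) + K + near_bound j.

Definition quasi_geodesic (n : nat) (x : nat -> X) : Prop :=
  forall i i', (i <= i' <= n)%N ->
    K^-1 * (i' - i)%:R - K <= mdist (x i) (x i') <= K * (i' - i)%:R + K.

(** From a point of the geodesic its ends have Gromov product 0.  A chain that joins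
    these ends far away from the point would force a large product by
    [gromov_chain]. *)
Lemma geodesic_near_quasi_geodesic n j x c (t : R) : (n <= 2 ^ j)%N ->
  quasi_geodesic n x -> geodesic (x 0%N) (x n) c -> 0 <= t <= mdist (x 0%N) (x n) ->
  exists2 i, (i <= n)%N & mdist (c t) (x i) <= near_bound j.
Proof.
move=> nj qx gc tL; apply: contrapT => far.
have {}far i : (i <= n)%N -> near_bound j < mdist (x i) (c t).
  move=> ij; rewrite ltNge; apply/negP => h; apply: far; exists i => //.
  by rewrite metric_sym.
have h := @gromov_chain (c t) (near_bound j - K) j n x nj.
have := geodesic_mdistl gc tL; have := geodesic_mdistr gc tL => h1 h2.
have /h : forall i, (i <= n)%N -> near_bound j - K <= mdist (x i) (c t).
  by move=> i /far; have := K_ge1; lra.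
have step i : (i < n)%N -> near_bound j - K <= gromov (x i) (x i.+1) (c t).
  move=> ij; have /andP[_] := qx i i.+1 ltac:(by rewrite leqnSn).
  rewrite subSnn mulr1 => hi; have := far i (ltnW ij); have := far i.+1 ij.
  by rewrite /gromov; lra.
move=> /(_ step); rewrite /gromov [mdist (x n) _]metric_sym h1 h2 /near_bound.
by lra.
Qed.

(** Each point of the geodesic is near some [x i]; walking along it in unit steps,
    there is a step at which the index passes from [i <= m] to [i' >= m].  The
    points [x i] and [x i'] are close, hence so are their indices, so [x m] is close
    to both and to the geodesic. *)
Lemma quasi_geodesic_center n j m x : (n <= 2 ^ j)%N -> (m <= n)%N ->
  quasi_geodesic n x -> gromov (x 0%N) (x n) (x m) <= center_bound j.
Proof.
move=> nj mn qx; have [c gc] := geo (x 0%N) (x n).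
set D := near_bound j.
have D0 : 0 <= D.
  have : 0 <= delta * j%:R by rewrite mulr_ge0.
  by have := K_ge1; rewrite /D /near_bound; lra.
set L := mdist (x 0%N) (x n).
have L0 : 0 <= L := mdist_ge0 _ _.
have nearD s : 0 <= s <= L -> exists2 i, (i <= n)%N & mdist (c s) (x i) <= D.
  by move=> sL; exact: geodesic_near_quasi_geodesic sL.
have [s [s' [i [i' [sL s'L ss' imi' hi]]]]] : exists s s' i i',
    [/\ 0 <= s <= L, 0 <= s' <= L, `|s - s'| <= 1, (i <= m <= i')%N /\ (i' <= n)%N &
        mdist (c s) (x i) <= D /\ mdist (c s') (x i') <= D].
  pose pos l := Num.min l%:R L.
  have posL l : 0 <= pos l <= L by rewrite /pos le_min ler0n L0/= ge_min lexx orbT.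
  pose P l := exists2 i, (i <= m)%N & mdist (c (pos l)) (x i) <= D.
  have P0 : P 0%N.
    exists 0%N => //; rewrite /pos min_l ?L0//.
    by have [-> _ _] := gc; rewrite mdistxx.
  have [[i im hi]|[l [[i im hi] nP]]] := nat_switch (Num.truncn L).+1 P0.
    exists L, L, i, n; rewrite L0 lexx subrr normr0 im mn leqnn; split=> //.
    have -> : L = pos (Num.truncn L).+1.
      by rewrite /pos min_r// ltW// truncnS_gt.
    split=> //; rewrite /pos min_r; last by rewrite ltW// truncnS_gt.
    by have [_ -> _] := gc; rewrite mdistxx.
  have [i' i'n hi'] := nearD _ (posL l.+1).
  exists (pos l), (pos l.+1), i, i'; rewrite !posL i'n; split=> //.
    rewrite /pos -natr1 !minEle; case: ifP => [|/negbT]; case: ifP => [|/negbT];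
      rewrite -?ltNge ler_norml => *; apply/andP; split; lra.
  have mi' : (m < i')%N by rewrite ltnNge; apply/negP => i'm; apply: nP; exists i'.
  by rewrite im ltnW.
case: imi' => /andP[im mi'] i'n; case: hi => hi hi'.
have hcc : mdist (c s) (c s') <= 1.
  by have [_ _ ->] := gc; rewrite ?in_itv.
have hii : mdist (x i) (x i') <= 2 * D + 1.
  have := metric_triangle (x i) (c s) (x i'); have := metric_triangle (c s) (c s') (x i').
  by rewrite [mdist (x i) (c s)]metric_sym; lra.
have /andP[low _] := qx i i' ltac:(by rewrite (leq_trans im)).
have /andP[_ up] := qx i m ltac:(by rewrite im).
have K0 : 0 < K := lt_le_trans ltr01 K_ge1.
have dii : (m - i)%:R <= K * (2 * D + 1 + K).
  apply: (@le_trans _ _ (i' - i)%:R); first by rewrite ler_nat leq_sub2r.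
  by rewrite -ler_pdivrMl//; lra.
have hm : mdist (x i) (x m) <= K * (K * (2 * D + 1 + K)) + K.
  by apply: (le_trans up); rewrite lerD2r ler_pM2l.
have := geodesic_mdistl gc sL; have := geodesic_mdistr gc sL.
have := metric_triangle (x m) (x i) (c s).
have := metric_triangle (x 0%N) (c s) (x m); have := metric_triangle (x n) (c s) (x m).
rewrite /center_bound -/D /gromov [mdist (x n) (c s)]metric_sym.
rewrite [mdist (x m) (c s)]metric_sym [mdist (x m) (x i)]metric_sym.
rewrite [mdist (x i) (c s)]metric_sym -/L.
by lra.
Qed.

End QuasiGeodesic.

(** * Reduced words *)

Section Words.
Variable r : nat.
Implicit Types (u v w : seq (letter r)) (g h : freegroup r).

(** Defined on all words, so that products of subwords need no proof of
    reducedness. *)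
Definition word_elt w : freegroup r :=
  FreeGroup (wmul_reduced w (isT : reduced (r := r) [::])).

Lemma word_elt_cat u v : word_elt (u ++ v) = (word_elt u * word_elt v)%g.
Proof.
apply: val_inj => /=; rewrite -wmulA ?wmul_reduced//.
by rewrite /wmul foldr_cat.
Qed.

Lemma word_word_elt w : reduced w -> word (word_elt w) = w.
Proof. exact: wmulw1. Qed.

Lemma word_eltK g : word_elt (word g) = g.
Proof. by apply: val_inj; rewrite /= wmulw1 ?wordP. Qed.

Lemma word_elt_nil : word_elt [::] = 1%g.
Proof. exact: val_inj. Qed.

Lemma word_elt_winv w : reduced w -> word_elt (winv w) = (word_elt w)^-1%g.
Proof. by move=> rw; apply: val_inj; rewrite /= !wmulw1// winv_reduced. Qed.

Lemma reduced_cat u v : reduced (u ++ v) -> reduced u /\ reduced v.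
Proof. by rewrite /reduced => /cat_sorted2[]. Qed.

Lemma reduced_catl u v : reduced (u ++ v) -> reduced u.
Proof. by case/reduced_cat. Qed.

Lemma reduced_catr u v : reduced (u ++ v) -> reduced v.
Proof. by case/reduced_cat. Qed.

Lemma reduced_common_prefix u v : reduced u -> reduced v ->
  exists c a b, [/\ u = c ++ a, v = c ++ b & reduced (winv a ++ b)].
Proof.
elim: u v => [|x u IHu] v ru rv; first by exists [::], [::], v.
case: v rv => [_|y v rv].
  by exists [::], (x :: u), [::]; split=> //; rewrite cats0 winv_reduced.
have [<-|xy] := eqVneq x y.
  have [c [a [b [-> -> h]]]] := IHu v (reduced_behead ru) (reduced_behead rv).
  by exists (x :: c), a, b.
exists [::], (x :: u), (y :: v); split => //.
have := winv_reduced ru; rewrite /winv /= rev_cons /reduced.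
case: (rev (map _ u)) => [|z s] /=; first by rewrite linvK eq_sym xy.
rewrite cat_path last_rcons => -> /=.
by rewrite linvK eq_sym xy /=.
Qed.

End Words.

(** * Displacements and cancellation *)

Section OrbitLength.
Variables (R : realType) (X : metricType R) (o : X) (r : nat).
Variable rho : {multiplicative freegroup r -> isom X}.
Implicit Types (u v w : seq (letter r)) (g h : freegroup r).

Definition orbit_length w : R := mdist o (orbit_map o rho (word_elt w)).

(** The Gromov product of [u^-1 o] and [v o] at [o], or equivalently of [o] and
    [u v o] at [u o]: the defect of additivity of the displacement. *)
Definition cancellation u v : R :=
  (orbit_length u + orbit_length v - orbit_length (u ++ v)) / 2.

Lemma orbit_map_mulE g h : orbit_map o rho (g * h)%g = rho g (orbit_map o rho h).
Proof. by rewrite /orbit_map gmulfM. Qed.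

Lemma mdist_orbit_map g h k : mdist (orbit_map o rho (k * g)%g)
  (orbit_map o rho (k * h)%g) = mdist (orbit_map o rho g) (orbit_map o rho h).
Proof. by rewrite !orbit_map_mulE isom_mdist. Qed.

Lemma orbit_map1 : orbit_map o rho 1%g = o.
Proof.
suff h : rho 1%g = 1%g :> isom X by exact: (congr1 (fun f : isom X => f o) h).
by apply: (mulgI (rho 1%g : isom X)); rewrite mulg1 -[LHS]gmulfM mulg1.
Qed.

Lemma mdist_orbit_map1 g h : mdist (orbit_map o rho g) (orbit_map o rho h) =
  mdist o (orbit_map o rho (g^-1 * h)%g).
Proof. by rewrite -(mdist_orbit_map g h g^-1%g) mulVg orbit_map1. Qed.

Lemma mdist_orbit_map_cat u v w : mdist (orbit_map o rho (word_elt (u ++ v)))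
  (orbit_map o rho (word_elt (u ++ w))) =
  mdist (orbit_map o rho (word_elt v)) (orbit_map o rho (word_elt w)).
Proof. by rewrite !word_elt_cat mdist_orbit_map. Qed.

Lemma mdist_orbit_map_catl u v : mdist (orbit_map o rho (word_elt u))
  (orbit_map o rho (word_elt (u ++ v))) = orbit_length v.
Proof.
by rewrite -{1}[u]cats0 mdist_orbit_map_cat word_elt_nil orbit_map1.
Qed.

Lemma orbit_length_ge0 w : 0 <= orbit_length w.
Proof. exact: mdist_ge0. Qed.

Lemma orbit_length_nil : orbit_length [::] = 0.
Proof. by rewrite /orbit_length word_elt_nil orbit_map1 mdistxx. Qed.

Lemma orbit_length_cat u v :
  orbit_length (u ++ v) = orbit_length u + orbit_length v - 2 * cancellation u v.
Proof. by rewrite /cancellation; field. Qed.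

Lemma cancellation_nil v : cancellation [::] v = 0.
Proof. by rewrite /cancellation orbit_length_nil/= add0r subrr mul0r. Qed.

Lemma cancellation_nilr u : cancellation u [::] = 0.
Proof. by rewrite /cancellation orbit_length_nil/= cats0 addr0 subrr mul0r. Qed.

Lemma cancellationE u v : cancellation u v =
  gromov o (orbit_map o rho (word_elt (u ++ v))) (orbit_map o rho (word_elt u)).
Proof.
rewrite /gromov [mdist (orbit_map o rho (word_elt (u ++ v))) _]metric_sym.
by rewrite mdist_orbit_map_catl.
Qed.

Lemma cancellation_ge0 u v : 0 <= cancellation u v.
Proof. by rewrite cancellationE gromov_ge0. Qed.

Lemma cancellation_trim a u v b : cancellation (a ++ u) (v ++ b) <=
  cancellation u v + orbit_length a + orbit_length b.
Proof.
have h1 := cancellation_ge0 a u; have h2 := cancellation_ge0 v b.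
rewrite /cancellation in h1 h2 *.
have : orbit_length (u ++ v) <= orbit_length a + orbit_length ((a ++ u) ++ v ++ b)
    + orbit_length b.
  rewrite -(mdist_orbit_map_catl a (u ++ v)) /orbit_length.
  apply: le_trans (metric_triangle _ o _) _.
  rewrite metric_sym -addrA lerD2l.
  apply: le_trans (metric_triangle _ (orbit_map o rho (word_elt ((a ++ u) ++ v ++ b))) _) _.
  rewrite lerD2l metric_sym.
  have := mdist_orbit_map_catl (a ++ u ++ v) b.
  by rewrite -!catA => ->.
by lra.
Qed.

Section Hyperbolic.
Variable delta : R.
Hypothesis hyp : hyperbolic X delta.

(** [hyperbolic_le] at the point [u' u o], applied to [u' o], [o] and [u' u v o]. *)
Lemma cancellation_catl (A : R) (u' u v : seq (letter r)) :
  cancellation u v <= A -> A + delta < orbit_length u - cancellation u' u ->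
  cancellation (u' ++ u) v <= A + delta.
Proof.
have -> : cancellation u v = gromov (orbit_map o rho (word_elt u'))
    (orbit_map o rho (word_elt (u' ++ u ++ v))) (orbit_map o rho (word_elt (u' ++ u))).
  rewrite cancellationE /gromov !mdist_orbit_map_catl mdist_orbit_map_cat.
  by rewrite -!/(orbit_length _).
rewrite [cancellation (u' ++ u) v]cancellationE -catA => h1 h2.
apply: hyperbolic_le hyp h1 _; apply: lt_le_trans h2 _.
rewrite gromovC /gromov mdist_orbit_map_catl -!/(orbit_length _) /cancellation.
by lra.
Qed.

(** [hyperbolic_le] at the point [u o], applied to [u v o], [u v v' o] and [o]. *)
Lemma cancellation_catr (A : R) (u v v' : seq (letter r)) :
  cancellation u v <= A -> A + delta < orbit_length v - cancellation v v' ->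
  cancellation u (v ++ v') <= A + delta.
Proof.
rewrite !cancellationE ![gromov o _ (orbit_map o rho (word_elt u))]gromovC => h1 h2.
apply: hyperbolic_le hyp h1 _; apply: lt_le_trans h2 _.
rewrite -cancellationE /gromov catA.
rewrite ![mdist _ (orbit_map o rho (word_elt u))]metric_sym -catA.
rewrite !mdist_orbit_map_catl catA mdist_orbit_map_catl /cancellation.
by lra.
Qed.

Variables (N : nat) (A B S : R).
Hypothesis N_gt0 : (0 < N)%N.
Hypothesis delta_ge0 : 0 <= delta.
Hypothesis A_ge0 : 0 <= A.
Hypothesis AB : 2 * A + 3 * delta < B.
Hypothesis blockA : forall u v, size u = N -> size v = N -> reduced (u ++ v) ->
  cancellation u v <= A.
Hypothesis blockB : forall u, size u = N -> reduced u -> B <= orbit_length u.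
Hypothesis shortS : forall u, (size u <= N)%N -> reduced u -> orbit_length u <= S.

(** The local condition propagates: the last block of [u] is long compared with the
    cancellation before it, which is controlled by induction, so it hides the rest
    of [u] from [v]. *)
Lemma cancellation_blocks_block m u v : size u = (m * N)%N -> size v = N ->
  reduced (u ++ v) -> cancellation u v <= A + delta.
Proof.
elim: m u v => [|m IHm] u v su sv ruv.
  by rewrite (size0nil su) cancellation_nil addr_ge0.
rewrite -(cat_take_drop (m * N) u) in ruv *.
set u' := take _ _ in ruv *; set u1 := drop _ _ in ruv *.
have su' : size u' = (m * N)%N by rewrite size_takel// su leq_mul.
have su1 : size u1 = N by rewrite size_drop su mulSn addnK.
have h1 := IHm _ _ su' su1 (reduced_catl ruv).
rewrite -catA in ruv.
have h2 := blockA su1 sv (reduced_catr ruv).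
have h3 := blockB su1 (reduced_catl (reduced_catr ruv)).
by apply: cancellation_catl h2 _; have := AB; have := delta_ge0; lra.
Qed.

Lemma cancellation_block_blocks m u v : size u = N -> size v = (m * N)%N ->
  reduced (u ++ v) -> cancellation u v <= A + delta.
Proof.
elim: m u v => [|m IHm] u v su sv ruv.
  by rewrite (size0nil sv) cancellation_nilr addr_ge0.
rewrite -(cat_take_drop N v) in ruv *.
set v1 := take _ _ in ruv *; set v' := drop _ _ in ruv *.
have sv1 : size v1 = N by rewrite size_takel// sv mulSn leq_addr.
have sv' : size v' = (m * N)%N by rewrite size_drop sv mulSn addKn.
have h1 := IHm _ _ sv1 sv' (reduced_catr ruv).
rewrite catA in ruv.
have h2 := blockA su sv1 (reduced_catl ruv).
have h3 := blockB sv1 (reduced_catr (reduced_catl ruv)).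
by apply: cancellation_catr h2 _; have := AB; have := delta_ge0; lra.
Qed.

Lemma cancellation_blocks m n u v : size u = (m * N)%N -> size v = (n * N)%N ->
  reduced (u ++ v) -> cancellation u v <= A + 2 * delta.
Proof.
case: m => [|m] su sv ruv.
  by rewrite (size0nil su) cancellation_nil addr_ge0 ?mulr_ge0.
rewrite -(cat_take_drop (m * N) u) in ruv *.
set u' := take _ _ in ruv *; set u1 := drop _ _ in ruv *.
have su' : size u' = (m * N)%N by rewrite size_takel// su leq_mul.
have su1 : size u1 = N by rewrite size_drop su mulSn addnK.
have h1 := cancellation_blocks_block su' su1 (reduced_catl ruv).
rewrite -catA in ruv.
have h2 := cancellation_block_blocks su1 sv (reduced_catr ruv).
have h3 := blockB su1 (reduced_catl (reduced_catr ruv)).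
rewrite (_ : A + 2 * delta = A + delta + delta); last by ring.
by apply: cancellation_catl h2 _; have := AB; have := delta_ge0; lra.
Qed.

(** Words whose length is not a multiple of [N] are trimmed at their outer ends, by
    pieces of bounded displacement. *)
Lemma cancellation_le u v : reduced (u ++ v) ->
  cancellation u v <= A + 2 * delta + S + S.
Proof.
move=> ruv.
rewrite -(cat_take_drop (size u %% N) u) -(cat_take_drop (size v %/ N * N) v) in ruv *.
set a := take _ u in ruv *; set u' := drop _ u in ruv *.
set v' := take _ v in ruv *; set b := drop _ v in ruv *.
apply: le_trans (cancellation_trim _ _ _ _) _.
have su' : size u' = (size u %/ N * N)%N.
  by rewrite size_drop {1}(divn_eq (size u) N) addnK.
have sv' : size v' = (size v %/ N * N)%N by rewrite size_takel// leq_divM.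
have ra := reduced_catl (reduced_catl ruv).
have rb := reduced_catr (reduced_catr ruv).
have ruv' : reduced (u' ++ v').
  by move: ruv; rewrite -catA => /reduced_catr; rewrite catA => /reduced_catl.
have Sa : orbit_length a <= S.
  apply: shortS ra; rewrite size_takel ?leq_mod//.
  by rewrite ltnW// ltn_pmod.
have Sb : orbit_length b <= S.
  apply: shortS rb; rewrite size_drop {1}(divn_eq (size v) N).
  by rewrite addKn ltnW// ltn_pmod.
by have := cancellation_blocks su' sv' ruv'; lra.
Qed.

End Hyperbolic.
End OrbitLength.

Lemma affine_lt_exp2 (R : realType) (a b : R) :
  exists j : nat, a * j%:R + b < (2 ^ j)%:R.
Proof.
pose i := Num.truncn (2 * `|a| + `|b|); exists (i + i)%N.
have hi : 2 * `|a| + `|b| < i.+1%:R.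
  by rewrite /i; apply: truncnS_gt.
have h2 : i.+1%:R <= (2 ^ i)%:R :> R by rewrite ler_nat ltn_expl.
rewrite expnD natrM natrD.
have := ler_norm a; have := ler_norm b; have := normr_ge0 a; have := normr_ge0 b.
move: h2 hi; rewrite -natr1; set I := i%:R; set P := (2 ^ i)%:R.
have I0 : 0 <= I :> R by rewrite ler0n.
move=> h2 hi b0 a0 lb la.
have s1 : a * (I + I) <= 2 * `|a| * I by nra.
have s2 : `|b| <= `|b| * (I + 1) by nra.
have s3 : (2 * `|a| + `|b|) * (I + 1) < (I + 1) * (I + 1) by rewrite ltr_pM2r; lra.
have s4 : (I + 1) * (I + 1) <= P * P by nra.
by nra.
Qed.

(** * Comparison of nearby representations *)

Section Schottky.
Variables (R : realType) (X : metricType R) (o : X) (r : nat) (delta : R).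
Hypothesis delta_ge0 : 0 <= delta.
Hypothesis hyp : hyperbolic X delta.
Hypothesis geo : geodesic_space X.
Implicit Types (rho : {multiplicative freegroup r -> isom X}).
Implicit Types (u v w : seq (letter r)).

Definition bounded_cancellation rho (C : R) : Prop :=
  forall u v, reduced (u ++ v) -> cancellation o rho u v <= C.

Lemma cancellation_quasi_geodesic rho (K : R) j u v : 1 <= K ->
  (forall w, reduced w ->
    K^-1 * (size w)%:R - K <= orbit_length o rho w <= K * (size w)%:R + K) ->
  reduced (u ++ v) -> (size (u ++ v) <= 2 ^ j)%N ->
  cancellation o rho u v <= center_bound delta K j.
Proof.
move=> K1 qi ruv suv; pose x i := orbit_map o rho (word_elt (take i (u ++ v))).
have qx : quasi_geodesic K (size (u ++ v)) x.
  move=> i i' /andP[ii' i'n]; set t := take i' (u ++ v).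
  have tE : t = take i (u ++ v) ++ drop i t.
    by rewrite -{1}(cat_take_drop i t) /t take_takel.
  rewrite /x -/t tE mdist_orbit_map_catl.
  have <- : size (drop i t) = (i' - i)%N by rewrite size_drop size_takel.
  apply: qi; have := ruv; rewrite -(cat_take_drop i' (u ++ v)) -/t.
  by move=> /reduced_catl; rewrite {1}tE => /reduced_catr.
have := @quasi_geodesic_center _ _ _ delta_ge0 hyp geo _ K1 _ j (size u) x suv _ qx.
rewrite /x take0 take_size take_size_cat// word_elt_nil orbit_map1 -cancellationE.
by apply; rewrite size_cat leq_addr.
Qed.

Lemma schottky_orbit_length rho : schottky o rho -> exists2 K : R, 1 <= K &
  forall w, reduced w ->
    K^-1 * (size w)%:R - K <= orbit_length o rho w <= K * (size w)%:R + K.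
Proof.
move=> [K K1 qi]; exists K => // w rw.
have := qi 1%g (word_elt w).
by rewrite invg1 mul1g /word_length word_word_elt// orbit_map1.
Qed.

(** The block length [2 ^ j] is chosen so that the displacement of a block exceeds
    twice the cancellation between two blocks, with a margin that absorbs an error
    of 1 in each displacement; whence a statement on all representations that are
    close to [rho_oo] on finitely many words, with a common bound. *)
Lemma bounded_cancellation_stable rho_oo : schottky o rho_oo ->
  exists N C, forall rho, (forall w, (size w <= N)%N ->
      `|orbit_length o rho w - orbit_length o rho_oo w| <= 1) ->
    bounded_cancellation rho C.
Proof.
move=> /schottky_orbit_length[K K1 qi].
pose lin j := K * (2 * (center_bound delta K j.+1 + 2) + 3 * delta + K + 1).
have [j hj] : exists j, lin j < (2 ^ j)%:R.
  have [j hj] := affine_lt_exp2 (K * (2 * (2 * K * K + 1) * delta)) (lin 0%N).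
  exists j; apply: le_lt_trans hj.
  rewrite /lin /center_bound /near_bound -!natr1 le_eqVlt; apply/orP; left.
  by apply/eqP; ring.
pose N := (2 ^ j)%N; pose A := center_bound delta K j.+1 + 2.
pose S := K * N%:R + K + 1.
exists (N + N)%N, (A + 2 * delta + S + S) => rho near_rho u v ruv.
have K0 : 0 < K by lra.
have N0 : (0 < N)%N by rewrite expn_gt0.
apply: (@cancellation_le _ _ _ _ _ _ hyp N A (K^-1 * N%:R - K - 1) S) => //.
- have : 0 <= delta * j.+1%:R by rewrite mulr_ge0.
  rewrite /A /center_bound; set d := _ * _; rewrite /near_bound -/d => d0.
  suff : 0 <= K * (K * (2 * (K + d + 1) + 1 + K)) by lra.
  by rewrite !mulr_ge0//; lra.
- have : lin j < K * (K^-1 * N%:R) by rewrite mulrA divff ?mul1r// gt_eqF.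
  by rewrite /lin ltr_pM2l// -/A; lra.
- move=> {ruv} {}u {}v su sv ruv; have [ru rv] := reduced_cat ruv.
  have := @cancellation_quasi_geodesic rho_oo K j.+1 u v K1 qi ruv.
  rewrite size_cat su sv expnS mul2n addnn => /(_ (leqnn _)).
  have := near_rho u; have := near_rho v; have := near_rho (u ++ v).
  rewrite size_cat su sv leqnn leq_addr => /(_ isT) + /(_ isT) + /(_ isT).
  rewrite /cancellation /A !ler_norml => /andP[a1 a2] /andP[b1 b2] /andP[c1 c2].
  by lra.
- move=> {ruv} {}u su ru; have := near_rho u; rewrite su leq_addr => /(_ isT).
  have /andP[] := qi u ru; rewrite su ler_norml => h1 _ /andP[h2 h3].
  by lra.
- move=> {ruv} {}u su ru; have := near_rho u (leq_trans su (leq_addr _ _)).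
  have /andP[_] := qi u ru; rewrite ler_norml => h1 /andP[h2 h3].
  have : K * (size u)%:R <= K * N%:R by rewrite ler_pM2l// ler_nat.
  by rewrite /S; lra.
Qed.

(** For actions with bounded cancellation the Gromov product is that of the Cayley
    tree, with the displacement of the common prefix instead of its length. *)
Lemma gromov_common_prefix rho (C : R) (c a b : seq (letter r)) :
  bounded_cancellation rho C ->
  reduced (c ++ a) -> reduced (c ++ b) -> reduced (winv a ++ b) ->
  `|gromov (orbit_map o rho (word_elt (c ++ a))) (orbit_map o rho (word_elt (c ++ b))) o
    - orbit_length o rho c| <= 2 * C.
Proof.
move=> bc ra rb rab.
have h1 := bc _ _ ra; have h2 := bc _ _ rb; have h3 := bc _ _ rab.
have g1 := cancellation_ge0 o rho c a; have g2 := cancellation_ge0 o rho c b.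
have g3 := cancellation_ge0 o rho (winv a) b.
rewrite /gromov mdist_orbit_map_cat ![mdist _ o]metric_sym -!/(orbit_length _ _ _).
have ea : orbit_length o rho (winv a) = orbit_length o rho a.
  rewrite /orbit_length word_elt_winv ?(reduced_catr ra)//.
  have := mdist_orbit_map1 o rho (word_elt a) 1%g.
  by rewrite mulg1 orbit_map1 metric_sym => <-.
have eab : orbit_length o rho (winv a ++ b) =
   mdist (orbit_map o rho (word_elt a)) (orbit_map o rho (word_elt b)).
  rewrite /orbit_length word_elt_cat word_elt_winv ?(reduced_catr ra)//.
  by rewrite mdist_orbit_map1.
rewrite -eab; rewrite /cancellation ea in h1 h2 h3 g1 g2 g3.
by rewrite ler_norml; apply/andP; split; lra.
Qed.

(** Cut into blocks of length [N]: each contributes at most 1 for its own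
    displacement and [2 C] for the cancellation at its end. *)
Lemma orbit_length_compare rho1 rho2 (C : R) N : (0 < N)%N ->
  bounded_cancellation rho1 C -> bounded_cancellation rho2 C ->
  (forall w, (size w <= N)%N ->
    `|orbit_length o rho1 w - orbit_length o rho2 w| <= 1) ->
  forall m w, reduced w -> (size w <= m.+1 * N)%N ->
  `|orbit_length o rho1 w - orbit_length o rho2 w| <= (2 * C + 1) * m.+1%:R.
Proof.
move=> N0 bc1 bc2 near12.
have C0 : 0 <= C.
  by have := bc1 [::] [::] isT; rewrite cancellation_nil.
elim=> [|m IHm] w rw sw.
  rewrite mulr1; apply: le_trans (near12 w _) _; first by rewrite mul1n in sw.
  by lra.
rewrite -(cat_take_drop N w) in rw *.
set a := take N w in rw *; set b := drop N w in rw *.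
have sa : (size a <= N)%N by rewrite size_take; case: ltnP.
have sb : (size b <= m.+1 * N)%N by rewrite size_drop leq_subLR -mulSn.
have h1 := near12 _ sa; have h2 := IHm _ (reduced_catr rw) sb.
have := bc1 _ _ rw; have := bc2 _ _ rw.
have := cancellation_ge0 o rho1 a b; have := cancellation_ge0 o rho2 a b.
rewrite !orbit_length_cat -[m.+2%:R]natr1.
move: h1 h2; rewrite !ler_norml => /andP[? ?] /andP[? ?] *.
by apply/andP; split; lra.
Qed.

Variable Rep : nat -> {multiplicative freegroup r -> isom X}.
Variable Rep_oo : {multiplicative freegroup r -> isom X}.
Hypothesis Rep_cvg : forall (g : freegroup r) (e : R), 0 < e -> \forall k \near \oo,
  mdist (orbit_map o Rep_oo g) (orbit_map o (Rep k) g) < e.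
Hypothesis Rep_oo_schottky : schottky o Rep_oo.

(** There are finitely many words of length at most [n]. *)
Lemma orbit_length_near n : \forall k \near \oo, forall w, (size w <= n)%N ->
  `|orbit_length o (Rep k) w - orbit_length o Rep_oo w| <= 1.
Proof.
have near1 w : \forall k \near \oo,
    `|orbit_length o (Rep k) w - orbit_length o Rep_oo w| <= 1.
  have [N _ hN] := Rep_cvg (word_elt w) ltr01; exists N => // k /= /hN/=.
  rewrite /orbit_length.
  set p := orbit_map o (Rep k) _; set q := orbit_map o Rep_oo _.
  have := metric_triangle o p q; have := metric_triangle o q p.
  rewrite [mdist p q]metric_sym ler_norml => *.
  by apply/andP; split; lra.
have nearn m : \forall k \near \oo, forall t : m.-tuple (letter r),
    `|orbit_length o (Rep k) t - orbit_length o Rep_oo t| <= 1.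
  by apply: filter_forall => t; exact: near1.
have : \forall k \near \oo, forall m : 'I_n.+1, forall t : m.-tuple (letter r),
    `|orbit_length o (Rep k) t - orbit_length o Rep_oo t| <= 1.
  by apply: filter_forall => m; exact: nearn.
apply: filterS => k hk w sw.
by have := hk (Ordinal (sw : (size w < n.+1)%N)) (in_tuple w).
Qed.

(** Both products are, up to [2 C], the displacements of the common prefix of [g]
    and [h].  The block length [N] is such that the errors of
    [orbit_length_compare] add up to at most [(1 - a) * orbit_length o Rep_oo w]
    plus a constant; [E] must not depend on [k], hence the order of quantifiers. *)
Lemma gromov_orbit_compare (a : R) : 0 < a < 1 -> exists E : R,
  \forall k \near \oo, forall g h : freegroup r,
  a * gromov (orbit_map o Rep_oo g) (orbit_map o Rep_oo h) o - E <=
    gromov (orbit_map o (Rep k) g) (orbit_map o (Rep k) h) o /\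
  a * gromov (orbit_map o (Rep k) g) (orbit_map o (Rep k) h) o - E <=
    gromov (orbit_map o Rep_oo g) (orbit_map o Rep_oo h) o.
Proof.
move=> /andP[a0 a1].
have [N0 [C bcN]] := bounded_cancellation_stable Rep_oo_schottky.
have bc_oo : bounded_cancellation Rep_oo C.
  by apply: bcN => w _; rewrite subrr normr0.
have C0 : 0 <= C.
  by have := bc_oo [::] [::] isT; rewrite cancellation_nil.
have [K K1 qi] := schottky_orbit_length Rep_oo_schottky.
have K0 : 0 < K by lra.
pose e := 1 - a; have e0 : 0 < e by rewrite /e; lra.
pose N := (Num.truncn ((2 * C + 1) * K / e)).+1.
have hN : (2 * C + 1) * K <= e * N%:R.
  by rewrite [leRHS]mulrC -ler_pdivrMr// ltW// /N truncnS_gt.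
have N1 : (0 < N)%N by [].
pose C' := e * K + 2 * C + 1.
exists (C' + 4 * C).
have := orbit_length_near N0; have := orbit_length_near N.
apply: filterS2 => k nearN nearN0 g h.
have bck := bcN _ nearN0.
have cmp w : reduced w ->
    `|orbit_length o (Rep k) w - orbit_length o Rep_oo w| <=
    e * orbit_length o Rep_oo w + C'.
  move=> rw.
  have := @orbit_length_compare _ _ C N N1 bck bc_oo nearN (size w %/ N) w rw.
  move=> /(_ (ltnW (ltn_ceil _ N1))) /le_trans; apply.
  have /andP[low _] := qi w rw.
  have sw : (size w)%:R <= K * (orbit_length o Rep_oo w + K).
    by rewrite -ler_pdivrMl//; lra.
  have hd : (size w %/ N)%:R * N%:R <= (size w)%:R :> R.
    by rewrite -natrM ler_nat leq_divM.
  have N0R : 0 < N%:R :> R by rewrite ltr0n.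
  rewrite -[(size w %/ N).+1%:R]natr1 mulrDr mulr1.
  suff : (2 * C + 1) * (size w %/ N)%:R <= e * orbit_length o Rep_oo w + e * K.
    by rewrite /C'; lra.
  rewrite -mulrDr -(ler_pM2r N0R) -mulrA.
  apply: (@le_trans _ _ ((2 * C + 1) * (K * (orbit_length o Rep_oo w + K)))).
    by apply: ler_wpM2l; lra.
  rewrite mulrA [leRHS]mulrAC ler_wpM2r//.
  by have := orbit_length_ge0 o Rep_oo w; lra.
have [c [x [y [gE hE rxy]]]] := reduced_common_prefix (wordP g) (wordP h).
have := wordP g; rewrite gE => rcx; have := wordP h; rewrite hE => rcy.
have := gromov_common_prefix bck rcx rcy rxy.
have := gromov_common_prefix bc_oo rcx rcy rxy.
rewrite -gE -hE !word_eltK.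
have := cmp c (reduced_catl rcx).
have := orbit_length_ge0 o (Rep k) c; have := orbit_length_ge0 o Rep_oo c.
set Gk := gromov (orbit_map o (Rep k) g) _ _.
set G := gromov (orbit_map o Rep_oo g) _ _.
set Lk := orbit_length _ (Rep k) _; set L := orbit_length _ Rep_oo _.
have eK0 : 0 <= e * K by apply: mulr_ge0; apply: ltW.
have C'0 : 0 <= C' by rewrite /C'; lra.
have ae : a = 1 - e by rewrite /e; ring.
have e1 : e < 1 by rewrite /e; lra.
rewrite ae !ler_norml.
move=> L0 Lk0 /andP[h1 h2] /andP[g1 g2] /andP[k1 k2].
split.
- have : (1 - e) * G <= (1 - e) * (L + 2 * C) by rewrite ler_pM2l; lra.
  by nra.
- have : (1 - e) * Gk <= (1 - e) * (Lk + 2 * C) by rewrite ler_pM2l; lra.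
  have : (1 - e) * Lk <= (1 - e) * ((1 + e) * L + C') by rewrite ler_pM2l; lra.
  by nra.
Qed.

End Schottky.

(** * Hausdorff dimension under Hoelder maps *)

Section HausdorffDimension.
Local Open Scope ereal_scope.
Variables (R : realType).

Lemma le_poweR (s : R) (x y : \bar R) : (0 <= s)%R -> 0 <= x -> x <= y ->
  x `^ s <= y `^ s.
Proof.
move=> s0 x0 xy; apply: gt0_ler_poweR => //; rewrite in_itv/= leey andbT//.
exact: le_trans xy.
Qed.

Section OneSpace.
Variables (T : Type) (d : T -> T -> R).

Lemma diam_ge0 A : 0 <= diam d A.
Proof. by apply: ereal_sup_ubound; left. Qed.

Lemma diam_ge A x y : A x -> A y -> (d x y)%:E <= diam d A.
Proof. by move=> Ax Ay; apply: ereal_sup_ubound; right; exists (x, y). Qed.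

Lemma hausdorff_premeasure_ge0 s delta A : 0 <= hausdorff_premeasure d s delta A.
Proof.
apply: le_ereal_inf_tmp => _ [U _ <-].
by apply: nneseries_ge0 => *; exact: poweR_ge0.
Qed.

Lemma hausdorff_measure_eq0 s A : hausdorff_measure d s A = 0 <->
  forall delta : R, (0 < delta)%R -> hausdorff_premeasure d s delta A = 0.
Proof.
split=> [h delta d0|h].
  apply/eqP; rewrite eq_le hausdorff_premeasure_ge0 andbT -h.
  by apply: ereal_sup_ubound; exists delta.
apply/eqP; rewrite eq_le; apply/andP; split.
  by apply: ge_ereal_sup => _ [delta d0 <-]; rewrite h.
apply: le_trans (hausdorff_premeasure_ge0 s 1 A) _.
by apply: ereal_sup_ubound; exists 1%R => //=.
Qed.

Lemma hausdorff_dim_ge0 A : 0 <= hausdorff_dim d A.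
Proof. by apply: le_ereal_inf_tmp => _ [s [s0 _] <-]; rewrite lee_fin ltW. Qed.

End OneSpace.

Variables (T1 T2 : Type) (d1 : T1 -> T1 -> R) (d2 : T2 -> T2 -> R).
Variables (A : set T1) (B : set T2) (f : T2 -> T1) (a c : R).
Hypothesis a_gt0 : (0 < a)%R.
Hypothesis c_gt0 : (0 < c)%R.
Hypothesis d1_ge0 : forall x y, (0 <= d1 x y)%R.
Hypothesis fBA : forall y, B y -> A (f y).
Hypothesis fd : forall y y', B y -> B y' -> (d2 y y' <= c * d1 (f y) (f y') `^ a)%R.

Lemma diam_preimage U : diam d2 (B `&` f @^-1` U) <= c%:E * diam d1 U `^ a.
Proof.
apply: ge_ereal_sup => _ [->|[[y y'] [[/= By Uy] [By' Uy']] <-]].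
  by rewrite mule_ge0 ?poweR_ge0// lee_fin ltW.
apply: (@le_trans _ _ (c * d1 (f y) (f y') `^ a)%:E).
  by rewrite lee_fin fd.
rewrite EFinM; apply: lee_wpmul2l; first by rewrite lee_fin ltW.
rewrite -poweR_EFin; apply: le_poweR; first exact: ltW.
  by rewrite lee_fin.
exact: diam_ge.
Qed.

Lemma hausdorff_measure_preimage s : (0 < s)%R ->
  hausdorff_measure d1 s A = 0 -> hausdorff_measure d2 (s / a) B = 0.
Proof.
move=> s0 /hausdorff_measure_eq0 h; apply/hausdorff_measure_eq0 => delta delta0.
apply/eqP; rewrite eq_le hausdorff_premeasure_ge0 andbT.
apply/lee_addgt0Pr => e e0; rewrite add0e.
pose C := (c `^ (s / a))%R; have C0 : (0 < C)%R by rewrite powR_gt0.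
pose delta1 := ((delta / c) `^ a^-1)%R.
have delta10 : (0 < delta1)%R by rewrite powR_gt0// divr_gt0.
have : hausdorff_premeasure d1 s delta1 A < (e / C)%:E.
  by rewrite h// lte_fin divr_gt0.
move=> /ereal_inf_lt[_ [U [AU dU] <-]] sumU.
pose V i := B `&` f @^-1` U i.
have diamV i : diam d2 (V i) <= c%:E * diam d1 (U i) `^ a by exact: diam_preimage.
apply: (@le_trans _ _ (\sum_(0 <= i <oo) (diam d2 (V i) `^ (s / a)))).
  apply: ereal_inf_lbound; exists V => //; split.
    move=> y By; have [i _ Ui] := AU _ (fBA By).
    by exists i.
  move=> i; apply: le_trans (diamV i) _.
  apply: (@le_trans _ _ (c%:E * delta1%:E `^ a)).
    apply: lee_wpmul2l; first by rewrite lee_fin ltW.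
    by apply: le_poweR; [exact: ltW|exact: diam_ge0|exact: dU].
  rewrite poweR_EFin -EFinM lee_fin /delta1 -powRrM mulVf ?gt_eqF// powRr1; last first.
    by rewrite divr_ge0 ?ltW.
  by rewrite mulrCA divff ?mulr1// gt_eqF.
apply: (@le_trans _ _ (\sum_(0 <= i <oo) (C%:E * diam d1 (U i) `^ s))).
  apply: lee_nneseries => [i _ _|i _]; first exact: poweR_ge0.
  have -> : C%:E * diam d1 (U i) `^ s = (c%:E * diam d1 (U i) `^ a) `^ (s / a).
    rewrite poweRM ?poweR_ge0//; last by rewrite lee_fin ltW.
    by rewrite -poweRrM [(a * _)%R]mulrC divfK ?gt_eqF.
  apply: le_poweR; [by rewrite divr_ge0 ?ltW|exact: diam_ge0|exact: diamV].
rewrite nneseriesZl; last by move=> *; exact: poweR_ge0.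
rewrite (_ : e%:E = C%:E * (e / C)%:E); last first.
  by rewrite -EFinM mulrC divfK ?gt_eqF.
by apply: lee_wpmul2l; [rewrite lee_fin ltW|exact: ltW].
Qed.

(** A Hoelder surjection from [A] onto [B] enters through a section [f : T2 -> T1]
    of it: covers of [A] pull back along [f] to covers of [B], with diameters
    controlled by [diam_preimage]. *)
Lemma hausdorff_dim_holder : a%:E * hausdorff_dim d2 B <= hausdorff_dim d1 A.
Proof.
apply: le_ereal_inf_tmp => _ [s [s0 hs] <-].
apply: (@le_trans _ _ (a%:E * (s / a)%:E)).
  apply: lee_wpmul2l; first by rewrite lee_fin ltW.
  apply: ereal_inf_lbound; exists (s / a)%R => //; split.
    by rewrite divr_gt0.
  exact: hausdorff_measure_preimage.
by rewrite -EFinM mulrC divfK ?gt_eqF.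
Qed.

End HausdorffDimension.

(** * Limit sets of comparable representations *)

Section LimitSets.
Variables (R : realType) (X : metricType R) (o : X) (r : nat).
Hypothesis Xcat : cat_m1 X.

Lemma gromov_bd_ge0 (xi zeta : boundary o) : (0 <= gromov_bd xi zeta)%E.
Proof.
have mem (eta : boundary o) : exists u, bd_class eta u.
  have [u us ->] := bd_classP eta; exists u; split=> //.
  exact: gromov_seq_equivxx.
have [u xiu] := mem xi; have [v zv] := mem zeta.
apply: (lee_cvg_to (cvg_cst 0%E) (gromov_bd_cvg Xcat xiu zv)).
by apply: nearW => n; rewrite lee_fin gromov_ge0.
Qed.

Lemma visual_dist_ge0 (xi zeta : boundary o) : 0 <= visual_dist o xi zeta.
Proof. by rewrite fine_ge0// expeR_ge0. Qed.

Variables rho1 rho2 : {multiplicative freegroup r -> isom X}.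
Variables (a E : R).
Hypothesis a_gt0 : 0 < a.
Hypothesis gr12 : forall g h : freegroup r,
  a * gromov (orbit_map o rho2 g) (orbit_map o rho2 h) o - E <=
    gromov (orbit_map o rho1 g) (orbit_map o rho1 h) o.
Hypothesis gr21 : forall g h : freegroup r,
  a * gromov (orbit_map o rho1 g) (orbit_map o rho1 h) o - E <=
    gromov (orbit_map o rho2 g) (orbit_map o rho2 h) o.

(** A sequence of group elements whose orbit converges under [rho1] also has a
    convergent orbit under [rho2], as its Gromov products tend to infinity for
    both. *)
Lemma limit_set_transfer (xi : boundary o) : limit_set o rho1 xi ->
  exists (zeta : boundary o) (g : nat -> freegroup r),
    bd_class xi (orbit_map o rho1 \o g) /\ bd_class zeta (orbit_map o rho2 \o g).
Proof.
move=> [g xig]; have gs1 : gromov_seq o (orbit_map o rho1 \o g).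
  by have [u _ uE] := bd_classP xi; rewrite uE in xig; case: xig.
have gs2 : gromov_seq o (orbit_map o rho2 \o g).
  apply/gromov_seqP => M; have [N hN] := (gromov_seqP _ _).1 gs1 ((M + E) / a).
  exists N => n m Nn Nm; apply: le_trans (gr21 _ _).
  have := hN n m Nn Nm; rewrite ler_pdivrMr// mulrC /=.
  by lra.
pose cl := [set v | gromov_seq o v /\ gromov_equiv o (orbit_map o rho2 \o g) v].
have clP : exists2 u, gromov_seq o u &
    cl = [set v | gromov_seq o v /\ gromov_equiv o u v].
  by exists (orbit_map o rho2 \o g).
exists (Boundary clP), g; split=> //=; split=> //.
exact: gromov_seq_equivxx.
Qed.

(** The lower bound on the products for [rho1] is multiplicative in [a] and additive
    in [E]; exponentiating, it becomes a Hoelder bound of exponent [a] and constant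
    [expR E] between visual distances of corresponding points. *)
Lemma hausdorff_dim_limit_set :
  (a%:E * hausdorff_dim (visual_dist o) (limit_set o rho1) <=
  hausdorff_dim (visual_dist o) (limit_set o rho2))%E.
Proof.
have /choice[f hf] : forall xi : boundary o, exists zeta : boundary o,
    limit_set o rho1 xi -> exists g : nat -> freegroup r,
    bd_class xi (orbit_map o rho1 \o g) /\ bd_class zeta (orbit_map o rho2 \o g).
  move=> xi; have [/limit_set_transfer[zeta h]|h] := pselect (limit_set o rho1 xi).
    by exists zeta.
  by exists xi.
apply: (@hausdorff_dim_holder _ _ _ _ _ _ _ f a (expR E)) => //.
- exact: expR_gt0.
- exact: visual_dist_ge0.
- by move=> xi /hf[g [_ h]]; exists g.
move=> xi zeta /hf[g [g1 g2]] /hf[h [h1 h2]].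
have c1 := gromov_bd_cvg Xcat g1 h1; have c2 := gromov_bd_cvg Xcat g2 h2.
have le12 : (a%:E * gromov_bd (f xi) (f zeta) - E%:E <= gromov_bd xi zeta)%E.
  apply: (lee_cvg_to (cvgeD _ (cvgeZl _ c2) (cvg_cst (- E%:E)%E)) c1) => //.
    by rewrite fin_num_adde_defl.
  by apply: nearW => n; rewrite /= lee_fin; exact: gr12.
have := gromov_bd_ge0 xi zeta; have := gromov_bd_ge0 (f xi) (f zeta).
rewrite /visual_dist; move: le12.
case: (gromov_bd (f xi) (f zeta)) => [t| |]//; last first.
  rewrite gt0_muley ?lte_fin//= addye// leye_eq => /eqP -> _ _ /=.
  by rewrite powR0 ?mulr0// gt_eqF.
case: (gromov_bd xi zeta) => [s| |]//=.
rewrite -EFinM -EFinD lee_fin => le _ _.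
by rewrite -expRM -expRD ler_expR; lra.
Qed.

End LimitSets.

(** * Convergence of the dimensions *)

(** Covers infinite limits, where the second inequality forces [h k] to be infinite
    eventually. *)
Lemma ereal_cvg_ratio (R : realType) (h : nat -> \bar R) (l : \bar R) :
  (0 <= l)%E -> (forall k, 0 <= h k)%E ->
  (forall a : R, 0 < a < 1 -> \forall k \near \oo,
    (a%:E * h k <= l /\ a%:E * l <= h k)%E) ->
  h k @[k --> \oo] --> l.
Proof.
move=> l0 h0 H; case: l l0 H => [l| |]// l0 H; last first.
  apply: cvg_near_cst; have := H (1 / 2) ltac:(lra).
  apply: filterS => k [_]; rewrite gt0_muley ?lte_fin; last by lra.
  by rewrite leye_eq => /eqP.
rewrite lee_fin in l0.
have fin : \forall k \near \oo, h k \is a fin_num.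
  have := H (1 / 2) ltac:(lra); apply: filterS => k [+ _].
  move: (h0 k); case: (h k) => [//| |//] _.
  by rewrite gt0_muley ?lte_fin//; lra.
apply: cvg_EFin => //; apply/cvgrPdist_le => /= e0 e00; move: (e0 : R) e00 => {e0} e e0.
(* close enough to 1 for both [l / a <= l + e] and [l - e <= a * l] *)
pose a := (l + 1) / (l + 1 + e).
have a01 : 0 < a < 1.
  by rewrite divr_gt0 ?ltr_pdivrMr/=; lra.
have aE : a * (l + 1 + e) = l + 1 by rewrite divfK// gt_eqF//; lra.
have /andP[a0 a1] := a01.
have := H a a01; apply: filterS2 fin => k /= /fineK <-.
rewrite -!EFinM !lee_fin => -[h1 h2].
move: (fine (h k)) h1 h2 => x h1 h2.
clearbody a; rewrite /=; rewrite ler_norml; apply/andP; split.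
- have : a * (x - l - e) <= 0 by lra.
  by rewrite pmulr_rle0// => ?; lra.
- by nra.
Qed.

(** Points are compact. *)
Lemma isom_cvg_pointwise (R : realType) (X : metricType R)
    (f : nat -> isom X) (g : isom X) (x : X) :
  f k @[k --> \oo] --> g ->
  forall e : R, 0 < e -> \forall k \near \oo, mdist (g x) (f k x) < e.
Proof.
move=> fg e e0.
have fg' : (f k : {compact-open, X -> X}) @[k --> \oo] -->
    (g : {compact-open, X -> X}).
  exact: (cvg_comp _ _ fg (@initial_continuous _ _
    (fun f : isom X => (f : {compact-open, X -> X})) g)).
have /compact_open_cvgP H := fg'.
have cx : compact [set x] by exact: compact_set1.
have oB : open (interior (ball (g x) e)) by exact: open_interior.
have gB : [set g y | y in [set x]] `<=` interior (ball (g x) e).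
  by move=> _ [y -> <-]; exact: (nbhsx_ballx _ _ e0).
have : \forall k \near \oo, [set f k y | y in [set x]] `<=` (ball (g x) e)^°.
  exact: H cx oB gB.
apply: filterS => k hk.
have : interior (ball (g x) e) (f k x) by apply: hk; exists x.
by move=> /interior_subset; rewrite ballEmdist.
Qed.

Theorem corollary1p8 (R : realType) (X : completeMetricType R) (o : X)
    (r : nat) (Rep : nat -> {multiplicative freegroup r -> isom X})
    (Rep_oo : {multiplicative freegroup r -> isom X}) :
  (2 <= r)%N ->
  cat_m1 X ->
  schottky o Rep_oo ->
  (forall g : freegroup r, Rep k g @[k --> \oo] --> Rep_oo g) ->
  hausdorff_dim (visual_dist o) (limit_set o (Rep k)) @[k --> \oo]
    --> hausdorff_dim (visual_dist o) (limit_set o Rep_oo).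
Proof.
move=> _ Xcat sch cvg_Rep.
apply: ereal_cvg_ratio => [|k|a a01]; try exact: hausdorff_dim_ge0.
have [E HE] := gromov_orbit_compare (ler0n R 2) (cat_m1_hyperbolic Xcat) (proj1 Xcat)
  (fun g e e0 => isom_cvg_pointwise o (cvg_Rep g) e0) sch a01.
have /andP[a0 _] := a01.
apply: filterS HE => k hk; split.
  by apply: (hausdorff_dim_limit_set Xcat a0 (E := E)) => g h; have [] := hk g h.
by apply: (hausdorff_dim_limit_set Xcat a0 (E := E)) => g h; have [] := hk g h.
Qed.
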